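(* Let $t$ be a positive integer and let $\lambda=(\lambda_1,\lambda_2,\dots,\lambda_r)$ be a partition. Then the $t$-Young complex $\Delta_t^\lambda$ is either contractible or homotopy equivalent to a wedge of spheres.
   Context: A partition $\lambda=(\lambda_1,\dots,\lambda_r)$ is a finite sequence of integers $\lambda_1\ge\lambda_2\ge\dots\ge\lambda_r\ge1$ ($r\ge1$), identified with its Young diagram: a top- and left-justified array of boxes with $\lambda_j$ boxes in row $j$, row $1$ being the top row. For a positive integer $t$, fill the box in row $j$ and column $i$ ($1\le j\le r$, $1\le i\le\lambda_j$) with the integer $(r-j)t+i$. The $t$-Young complex $\Delta_t^\lambda$ is the $(\lambda_1-1)$-dimensional pure simplicial complex whose facets are all sets $\{a_1,a_2,\dots,a_{\lambda_1}\}$ with $a_1<a_2<\dots<a_{\lambda_1}$ and such that $a_j$ is an entry of the $j$-th column of $\lambda$ for every $1\le j\le\lambda_1$. A simplicial complex is identified with its geometric realization when speaking of homotopy type. The spheres in a wedge need not all have the same dimension. *)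

(* Defs.v *)
From HB Require Import structures.
From mathcomp Require Import all_boot all_order all_algebra finmap.
From mathcomp Require Import all_classical all_reals all_analysis homotopy.

Set Implicit Arguments.
Unset Strict Implicit.
Unset Printing Implicit Defensive.

Import Order.TTheory GRing.Theory Num.Theory numFieldNormedType.Exports.

Local Open Scope classical_set_scope.
Local Open Scope fset_scope.
Local Open Scope ring_scope.

Record simplicial_complex (V : choiceType) := SimplicialComplex {
  faces : set {fset V};
  faces_finite : finite_set faces;
  faces_sub : forall s s' : {fset V}, s' `<=` s -> faces s -> faces s' }.

(* Barycentric coordinates. The complex being finite, the topology induced by
   pointwise convergence on V -> R is the usual one. *)
Definition barycentric (R : realType) (V : choiceType)
    (K : simplicial_complex V) : set {ptws V -> R} :=
  [set x | (forall v, 0 <= x v) /\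
    exists s : {fset V}, [/\ faces K s, forall v, v \notin s -> x v = 0 &
                             \sum_(v <- s) x v = 1]].

Definition realization (R : realType) (V : choiceType)
    (K : simplicial_complex V) : topologicalType := set_type (@barycentric R V K).

Arguments realization R {V} K.

Definition homotopic (R : realType) (X Y : topologicalType) (f g : X -> Y) :=
  exists H : R * X -> Y,
    [/\ {within (`[0, 1] `*` [set: X])%classic, continuous H},
        forall x, H (0, x) = f x & forall x, H (1, x) = g x].

Definition homotopy_equivalent (R : realType) (X Y : topologicalType) :=
  exists (f : X -> Y) (g : Y -> X),
    [/\ continuous f, continuous g, homotopic R (g \o f) idfun &
        homotopic R (f \o g) idfun].

Definition contractible (R : realType) (X : topologicalType) :=
  exists x0 : X, homotopic R (@idfun X) (cst x0).

Definition sphere (R : realType) (d : nat) : set 'rV[R]_d.+1 :=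
  [set x | \sum_(i < d.+1) x ord0 i ^+ 2 = 1].

Arguments sphere R d : clear implicits.

Lemma sphere_base_subproof (R : realType) (d : nat) :
  (delta_mx ord0 ord0 : 'rV[R]_d.+1) \in sphere R d.
Proof.
rewrite inE /sphere /= (bigD1 ord0) //= mxE !eqxx expr1n big1 ?addr0 //.
by move=> i /negbTE i0; rewrite mxE i0 andbF expr0n.
Qed.

Definition sphere_base (R : realType) (d : nat) : sphere R d :=
  exist _ (delta_mx ord0 ord0) (sphere_base_subproof R d).

Definition wedge_of_spheres (R : realType) (n : nat) (d : 'I_n -> nat)
    : topologicalType :=
  wedge (fun i : 'I_n => sphere_base R (d i)).

Definition is_partition (lam : seq nat) : bool :=
  [&& lam != [::], sorted geq lam & all (leq 1) lam].

(* Rows and columns are numbered from 0: this is the box in row j.+1 and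
   column i.+1 of the usual numbering. *)
Definition box_entry (t : nat) (lam : seq nat) (j i : nat) : nat :=
  ((size lam - j.+1) * t + i.+1)%N.

Definition column (t : nat) (lam : seq nat) (i : nat) : set nat :=
  [set box_entry t lam j i | j in
    [set j | (j < size lam)%N && (i < nth 0%N lam j)%N]].

Definition young_facet (t : nat) (lam : seq nat) (F : {fset nat}) : Prop :=
  exists a : seq nat,
    [/\ size a = head 0%N lam, sorted ltn a,
        forall i, (i < size a)%N -> column t lam i (nth 0%N a i) &
        F = [fset x in a]].

Definition young_faces (t : nat) (lam : seq nat) : set {fset nat} :=
  [set s | exists2 F : {fset nat}, young_facet t lam F & s `<=` F].

Lemma young_faces_finite (t : nat) (lam : seq nat) :
  finite_set (young_faces t lam).
Proof.
pose b := (size lam * t + head 0%N lam).+1.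
apply: (@sub_finite_set _ _ [set` fpowerset [fset x in iota 0 b]]); last first.
  exact: finite_fset.
move=> s [F [a [sza _ ha ->]] sF] /=; rewrite fpowersetE.
apply: fsubset_trans sF _; apply/fsubsetP => x; rewrite !in_fset.
move=> /(nthP 0%N)[i ia <-]; have [j /andP[jr _] <-] := ha i ia.
suff: box_entry t lam j i \in iota 0 b by [].
rewrite mem_iota leq0n add0n ltnS -sza; apply: leq_add ia.
by rewrite leq_mul2r leq_subr orbT.
Qed.

Lemma young_faces_sub (t : nat) (lam : seq nat) (s s' : {fset nat}) :
  s' `<=` s -> young_faces t lam s -> young_faces t lam s'.
Proof. by move=> s's [F yF sF]; exists F => //; exact: fsubset_trans sF. Qed.

Definition young_complex (t : nat) (lam : seq nat) : simplicial_complex nat :=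
  SimplicialComplex (young_faces_finite t lam) (@young_faces_sub t lam).

(* Main.v *)
Require Import Defs.
From mathcomp Require Import all_boot boolp zify.

(** Letter [i] of a facet has the form [m_i t + i + 1], where the [m_i] increase
    weakly and [m_i] is at least the number of rows of [lambda] of length at most
    [i]; so facets are words in single letters and blocks of length [t], the
    letters being the elements of the facet. Let [v] be the first position.
    Positions [v + 1, ..., v + t - 1] occur only together with [v], hence can be
    deleted. Then the deletion of [v] is the complex of words starting with a
    block, and the link of [v] is of the same kind as the original complex with
    some more positions deleted. If [w] is the first position after the block,
    moving that block to the front shows that the link of [v] is contained in
    the star of [w] in the deletion of [v]. Hence the complex is, up to homotopy,
    the wedge of its deletion and of the suspension of its link, and the theorem
    follows by induction.

    Homotopy equivalences between complexes are produced combinatorially, by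
    generalized collapses, until a complex in normal form is reached: the star
    of a vertex [x] together with further facets, whose boundaries lie in the
    star. Only collapses and this normal form are treated geometrically. *)

Set Implicit Arguments.
Unset Strict Implicit.
Unset Printing Implicit Defensive.

(** * Collapses and gluing of complexes *)

Implicit Types V W : finType.

(** Replacing a summand of a wedge by a homotopy equivalent one normally takes a homotopy extension
    argument. Here equivalence is an inductive relation generated by elementary moves on finite
    complexes, so its compatibility with attaching a suspension is checked move by move, without any
    topology. The price is that a base vertex has to be carried along: the complexes met in the
    induction may be disconnected (with a single letter left they can be finite sets of points), so
    goodness at one vertex passes to another only along a path of edges. The induction also meets
    the complex [[set set0]], whose realization is empty: its suspension is a 0-sphere, and it has
    no base vertex, whence [good_or_empty]. *)

Definition is_complex V (K : {set {set V}}) :=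
  set0 \in K /\ forall A B : {set V}, A \subset B -> B \in K -> A \in K.

Definition collapse V (K : {set {set V}}) (tau : {set V}) :=
  [set A in K | ~~ (tau \subset A)].

(** For a face [tau] and [p] outside it, this says that the link of [tau] is a cone with apex [p],
    so that removing the open star of [tau] does not change the homotopy type. *)
Definition coned V (K : {set {set V}}) (tau : {set V}) (p : V) :=
  forall A : {set V}, A \in K -> tau \subset A -> p |: A \in K.

Definition relabel V W (f : V -> W) (K : {set {set V}}) : {set {set W}} :=
  [set f @: A | A : {set V} in K].

(* Pointed equivalence of complexes.  The base points only matter for gluing;
   [peq_slide] says that they may move along edges. *)
Inductive peq : forall V W, {set {set V}} -> V -> {set {set W}} -> W -> Prop :=
| peq_refl V (K : {set {set V}}) w : is_complex K -> peq K w K w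
| peq_sym V W (K : {set {set V}}) w (L : {set {set W}}) x :
    peq K w L x -> peq L x K w
| peq_trans U V W (J : {set {set U}}) u (K : {set {set V}}) v
    (L : {set {set W}}) w : peq J u K v -> peq K v L w -> peq J u L w
| peq_collapse V (K : {set {set V}}) (tau : {set V}) (p w : V) :
    is_complex K -> tau != set0 -> tau != [set w] -> p \notin tau ->
    coned K tau p -> peq K w (collapse K tau) w
| peq_slide V (K : {set {set V}}) w x :
    is_complex K -> [set w; x] \in K -> peq K w K x
| peq_relabel V W (f : V -> W) (K : {set {set V}}) w :
    is_complex K -> injective f -> peq K w (relabel f K) (f w).

Lemma collapse_complex V (K : {set {set V}}) tau :
  is_complex K -> tau != set0 -> is_complex (collapse K tau).
Proof.
move=> [K0 Kdown] tau0; split=> [|A B AB]; first by rewrite inE K0 subset0.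
rewrite !inE => /andP[BK tauB]; rewrite (Kdown _ _ AB BK) /=.
by apply: contra tauB => /subset_trans; apply.
Qed.

(* As no apex lies in any [tau i], coning off one face never restores a removed
   one, so that the collapses can be done one after the other. *)
Lemma peq_collapses V (I : finType) (K L : {set {set V}}) (tau : I -> {set V})
    (p : I -> V) (w : V) :
  is_complex K -> (forall i, tau i != set0) -> (forall i, tau i != [set w]) ->
  (forall i j, p i \notin tau j) -> (forall i, coned K (tau i) (p i)) ->
  (forall A, A \in L = (A \in K) && [forall i, ~~ (tau i \subset A)]) ->
  peq K w L w.
Proof.
move=> cK tau0 tauw ptau Kcone LE.
pose Ks (s : seq I) := [set A in K | all (fun i => ~~ (tau i \subset A)) s].
suff {LE}: forall s, is_complex (Ks s) /\ peq K w (Ks s) w.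
  move=> /(_ (enum I)) [_]; congr peq; apply/setP => A; rewrite inE LE.
  congr (_ && _); apply/allP/forallP => h i; last by move=> _; exact: h.
  by apply: h; rewrite mem_enum.
elim=> [|i s [cKs IH]].
  have -> : Ks [::] = K by apply/setP => A; rewrite inE andbT.
  by split=> //; exact: peq_refl.
have -> : Ks (i :: s) = collapse (Ks s) (tau i).
  by apply/setP => A; rewrite !inE /=; case: (A \in K) => //=; rewrite andbC.
split; first exact: collapse_complex.
apply: peq_trans IH (peq_collapse cKs (tau0 i) (tauw i) (ptau i i) _) => A.
rewrite !inE => /andP[AK As] tauA; rewrite Kcone //=.
apply/allP => j js; have := allP As j js; apply: contra => /subsetP tauj.
apply/subsetP => x xj; have := tauj x xj; rewrite !inE => /predU1P[] // xE.
by have := ptau i j; rewrite -xE xj.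
Qed.

(** Adding or removing [z] pairs off the faces of [K] outside [L]. Each such face without [z] is
    removed with its open star by a generalized collapse with apex [z], and these open stars make up
    all of the difference. *)
Lemma peq_toggle V (K L : {set {set V}}) (z w : V) :
  is_complex K -> is_complex L -> [set w] \in L -> L \subset K ->
  (forall A, A \in K -> A \notin L -> (z |: A \in K) && (A :\ z \notin L)) ->
  peq K w L w.
Proof.
move=> cK [L0 Ldown] Lw /subsetP LK tog.
pose I : finType := {A : {set V} | (A \in K :\: L) && (z \notin A)}.
have IP (i : I) : [/\ val i \in K, val i \notin L & z \notin val i].
  by case: i => A /=; rewrite inE -andbA => /and3P[].
apply: (@peq_collapses _ I _ _ val (fun=> z)) => //.
- by move=> i; have [_ + _] := IP i; apply: contra => /eqP ->.
- by move=> i; have [_ + _] := IP i; apply: contra => /eqP ->.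
- by move=> _ i; have [] := IP i.
- move=> i A AK iA; have [iK iL _] := IP i.
  have AL : A \notin L by apply: contra iL; exact: Ldown.
  by have /andP[] := tog A AK AL.
move=> A; apply/idP/andP => [AL|[AK /forallP h]].
  split; first exact: LK.
  apply/forallP => i; have [_ + _] := IP i; apply: contra => /Ldown; exact.
apply: contraT => AL; have /andP[zA AzL] := tog A AK AL.
have Ai : (A :\ z \in K :\: L) && (z \notin A :\ z).
  rewrite !inE eqxx /= AzL /= andbT; case: cK => _; apply; last exact: AK.
  exact: subsetDl.
by have := h (Sub (A :\ z) Ai); rewrite SubK subsetDl.
Qed.
Lemma relabel_complex V W (f : V -> W) (K : {set {set V}}) :
  is_complex K -> is_complex (relabel f K).
Proof.
move=> [K0 Kdown]; split; first by rewrite -(imset0 f) imset_f.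
move=> A C AB /imsetP[B BK eC]; rewrite {C}eC in AB.
apply/imsetP; exists (B :&: f @^-1: A).
  by apply: Kdown BK; exact: subsetIl.
apply/setP => y; apply/idP/imsetP => [yA|[x]]; last by rewrite !inE => /andP[_ ?] ->.
have /imsetP[x xB yE] := subsetP AB _ yA.
by exists x => //; rewrite !inE xB -yE.
Qed.

Lemma peq_complex V W (K : {set {set V}}) w (L : {set {set W}}) x :
  peq K w L x -> is_complex K /\ is_complex L.
Proof.
elim=> {V W K w L x} //.
- by move=> V W K w L x _ [].
- by move=> U V W J u K v L w _ [? _] _ [].
- by move=> V K tau p w cK tau0 _ _ _; split=> //; exact: collapse_complex.
- by move=> V W f K w cK _; split=> //; exact: relabel_complex.
Qed.

(** * Attaching a suspension at a vertex *)

Section Gluing.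
Context {V W : finType}.
Implicit Types (S T : {set V + option W}) (A : {set V}) (B : {set W}).

Definition pole : V + option W := inr None.
Definition lpart S : {set V} := [set x | inl x \in S].
Definition rpart S : {set W} := [set y | inr (Some y) \in S].
Definition triple (b : bool) A B : {set V + option W} :=
  [set z | match z with inl x => x \in A | inr None => b
                      | inr (Some y) => y \in B end].

Lemma lpart_triple b A B : lpart (triple b A B) = A.
Proof. by apply/setP => x; rewrite !inE. Qed.

Lemma rpart_triple b A B : rpart (triple b A B) = B.
Proof. by apply/setP => x; rewrite !inE. Qed.

Lemma pole_triple b A B : (pole \in triple b A B) = b.
Proof. by rewrite inE. Qed.

Lemma triple_parts S : triple (pole \in S) (lpart S) (rpart S) = S.
Proof. by apply/setP => -[x|[y|]]; rewrite !inE. Qed.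

Lemma subset_parts S T : (S \subset T) =
  [&& (pole \in S) ==> (pole \in T), lpart S \subset lpart T &
      rpart S \subset rpart T].
Proof.
apply/subsetP/and3P => [ST|[/implyP Sp /subsetP Sl /subsetP Sr] [x|[y|]]].
- by split; [apply/implyP|apply/subsetP => x|apply/subsetP => x];
    rewrite ?inE; exact: ST.
- by have := Sl x; rewrite !inE.
- by have := Sr y; rewrite !inE.
- exact: Sp.
Qed.

Lemma parts_eq S T : (pole \in S) = (pole \in T) -> lpart S = lpart T ->
  rpart S = rpart T -> S = T.
Proof. by move=> p l r; rewrite -[S]triple_parts p l r triple_parts. Qed.

Lemma partsU S T : (lpart (S :|: T) = lpart S :|: lpart T) *
  (rpart (S :|: T) = rpart S :|: rpart T).
Proof. by split; apply/setP => x; rewrite !inE. Qed.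

Lemma partsD S T : (lpart (S :\: T) = lpart S :\: lpart T) *
  (rpart (S :\: T) = rpart S :\: rpart T).
Proof. by split; apply/setP => x; rewrite !inE. Qed.

Lemma parts_inl (x : V) : (lpart [set inl x] = [set x]) *
  (rpart [set inl x] = set0) * ((pole \in [set inl x]) = false).
Proof. by do !split; try (apply/setP => z); rewrite !inE. Qed.

Lemma parts_inr (y : W) : (lpart [set inr (Some y)] = set0) *
  (rpart [set inr (Some y)] = [set y]) *
  ((pole \in [set inr (Some y)]) = false).
Proof. by do !split; try (apply/setP => z); rewrite !inE. Qed.

Lemma parts_pole : (lpart [set pole] = set0) *
  (rpart [set pole] = set0) * ((pole \in [set pole]) = true).
Proof. by do !split; try (apply/setP => z); rewrite !inE. Qed.

Lemma parts0 : (lpart set0 = set0) * (rpart set0 = set0) *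
  ((pole \in set0) = false).
Proof. by do !split; try (apply/setP => z); rewrite !inE. Qed.

Lemma parts_imset_inl A : (lpart (inl @: A) = A) * (rpart (inl @: A) = set0) *
  ((pole \in inl @: A) = false).
Proof.
do !split; try (apply/setP => z); rewrite ?inE.
- by rewrite mem_imset // => ? ? [].
- by apply/imsetP => -[].
- by apply/imsetP => -[].
Qed.

Lemma parts_imset_inr B : (lpart ((inr \o some) @: B) = set0) *
  (rpart ((inr \o some) @: B) = B) * ((pole \in (inr \o some) @: B) = false).
Proof.
do !split; try (apply/setP => z); rewrite ?inE.
- by apply/imsetP => -[].
- by rewrite (mem_imset (f := inr \o some)) // => ? ? [].
- by apply/imsetP => -[].
Qed.

Definition partsE := (partsU, partsD, parts_inl, parts_inr, parts_pole, parts0,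
  parts_imset_inl, parts_imset_inr, in_setU, in_setD).

(* [D] with the suspension of [L] attached at the vertex [w]: the poles of the
   suspension are [w] and the new vertex [pole]. *)
Definition attach (D : {set {set V}}) (w : V) (L : {set {set W}}) :
    {set {set V + option W}} :=
  [set S : {set V + option W} | if pole \in S then (lpart S == set0) && (rpart S \in L)
    else (rpart S == set0) && (lpart S \in D) ||
         (lpart S \subset [set w]) && (rpart S \in L)].

Lemma attach_complex D w L :
  is_complex D -> is_complex L -> is_complex (attach D w L).
Proof.
move=> [D0 Ddown] [L0 Ldown]; split=> [|S T].
  by rewrite inE !partsE eqxx D0.
rewrite subset_parts !inE => /and3P[].
case: (pole \in T); case: (pole \in S) => //= _ lST rST.
- case/andP=> /eqP lT /Ldown ->//.
  by rewrite andbT -subset0 -lT.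
- case/andP=> /eqP lT /Ldown ->//.
  rewrite (subset_trans lST) ?lT ?sub0set ?orbT //.
- case/orP => /andP[].
    by move=> /eqP rT /Ddown ->//; rewrite -subset0 -rT rST.
  by move=> lT /Ldown ->//; rewrite (subset_trans lST lT) orbT.
Qed.
End Gluing.

(** By induction on the moves: each move on [D] extends by the identity to the suspension of [L].
    Only a slide, which moves the point of attachment itself, needs an intermediate complex. *)
Lemma peq_attachl V V' (D : {set {set V}}) w (D' : {set {set V'}}) w' W
    (L : {set {set W}}) : is_complex L -> peq D w D' w' ->
  peq (attach D w L) (inl w) (attach D' w' L) (inl w').
Proof.
move=> cL; elim=> {V V' D w D' w'}.
- by move=> V D w cD; apply: peq_refl; exact: attach_complex.
- by move=> V V' D w D' w' _; exact: peq_sym.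
- by move=> U V V' J u K v M x _ + _; exact: peq_trans.
- move=> V D tau p w cD tau0 tauw ptau Dcone.
  have tauE (S : {set V + option W}) : (inl @: tau \subset S) = (tau \subset lpart S).
    by rewrite subset_parts !partsE /= sub0set andbT.
  (* Faces of the attached suspension have their left part inside [[set w]], so none of them
     contains [tau], which is neither empty nor [[set w]]; the collapse touches [D] only. *)
  have -> : attach (collapse D tau) w L = collapse (attach D w L) (inl @: tau).
    apply/setP => S; rewrite !inE tauE; case: ifP => _.
      have [-> /=|] := eqVneq (lpart S) set0; last by [].
      by rewrite subset0 tau0 andbT.
    have [lS|lS] := boolP (lpart S \subset [set w]); last first.
      by rewrite !orbF andbA.
    suff -> : ~~ (tau \subset lpart S) by rewrite !andbT.
    apply/negP => tS; have := subset_trans tS lS.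
    by rewrite subset1 (negPf tau0) (negPf tauw).
  apply: (@peq_collapse _ _ _ (inl p)).
  + exact: attach_complex.
  + by rewrite -subset0 tauE !partsE subset0.
  + apply: contra tauw => /eqP e; have := congr1 lpart e.
    by rewrite !partsE => ->.
  + by rewrite mem_imset // => ? ? [].
  + move=> S; rewrite tauE !inE !partsE orFb set0U => + tS.
    have lS0 : lpart S != set0 by apply: contra tau0 => /eqP l0; rewrite -subset0 -l0.
    rewrite (negPf lS0) /=; case: ifP => //= _ /orP[/andP[-> /Dcone->//]|].
    case/andP=> lS; have := subset_trans tS lS.
    by rewrite subset1 (negPf tau0) (negPf tauw).
- move=> V D w x cD wxD; have [->|wx] := eqVneq w x.
    by apply: peq_refl; exact: attach_complex.
  (* [L] is joined to the whole edge from [w] to [x]. Collapsing this join towards either end yields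
     the suspension attached at that end, so [M] lies above both complexes. *)
  pose M := [set S : {set V + option W} |
    if pole \in S then (lpart S == set0) && (rpart S \in L)
    else (rpart S == set0) && (lpart S \in D) ||
         (lpart S \subset [set w; x]) && (rpart S \in L)].
  have cM : is_complex M.
    have [D0 Ddown] := cD; have [L0 Ldown] := cL; split=> [|S T].
      by rewrite inE !partsE eqxx D0.
    rewrite subset_parts !inE => /and3P[].
    case: (pole \in T); case: (pole \in S) => //= _ lST rST.
    + case/andP=> /eqP lT /Ldown ->//.
      by rewrite andbT -subset0 -lT.
    + case/andP=> /eqP lT /Ldown ->//.
      by rewrite (subset_trans lST) ?lT ?sub0set ?orbT.
    + case/orP => /andP[].
        by move=> /eqP rT /Ddown ->//; rewrite -subset0 -rT rST.
      by move=> lT /Ldown ->//; rewrite (subset_trans lST lT) orbT.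
  have toM (a b : V) : a != b -> [set w; x] = [set a; b] ->
      peq M (inl b) (attach D b L) (inl b).
    move=> ab e; have cA : is_complex (attach D b L) by exact: attach_complex.
    have bD : [set b] \in D.
      by case: cD => _; apply; last exact: wxD; rewrite e subsetUr.
    apply: (@peq_toggle _ _ _ (inl b)) => //.
    + by rewrite inE !partsE eqxx bD.
    + apply/subsetP => S; rewrite !inE; case: ifP => // _ /orP[->//|].
      by case/andP=> lS ->; rewrite e (subset_trans lS) ?orbT ?subsetUr.
    move=> S; rewrite !inE !partsE /= setD0 set0U /=.
    case: ifP => [_ -> //|_ /=]; rewrite !negb_or.
    have [->/=|r0 /=] := eqVneq (rpart S) set0.
      move=> /orP[->//|/andP[lS _]] /andP[/negP[]].
      by case: cD => _ /(_ _ _ lS); exact.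
    case/andP=> lS rS; rewrite rS !andbT => nlS.
    rewrite subUset sub1set lS andbT e !inE eqxx orbT /=.
    apply: contra nlS => /subsetP lb; apply/subsetP => z zS.
    have [->|zb] := eqVneq z b; rewrite ?inE ?eqxx //.
    have : z \in lpart S :\ b by rewrite in_setD1 zb.
    by move=> /lb; rewrite inE (negPf zb).
  apply: peq_trans (peq_sym _) _; first by apply: (toM x w); rewrite 1?eq_sym // setUC.
  apply: peq_trans (toM w x wx erefl); apply: peq_slide => //.
  by rewrite inE !partsE /= setU0 eqxx wxD.
- move=> V V' f D w cD finj.
  pose F (z : V + option W) : V' + option W :=
    match z with inl x => inl (f x) | inr y => inr y end.
  have Finj : injective F.
    by move=> [x|y] [x'|y'] //= [] => [/finj ->|->].
  have FE (S : {set V + option W}) : (lpart (F @: S) = f @: lpart S) *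
      (rpart (F @: S) = rpart S) * ((pole \in F @: S) = (pole \in S)).
    do !split.
    + apply/setP => x; rewrite inE; apply/imsetP/imsetP => [[[z|z] zS //= [->]]|[z zS ->]].
        by exists z; rewrite ?inE.
      by exists (inl z) => //; rewrite inE in zS.
    + by apply/setP => y; rewrite !inE (mem_imset _ (inr (Some y))).
    + by rewrite (mem_imset _ pole).
  suff -> : attach (relabel f D) (f w) L = relabel F (attach D w L).
    by apply: (@peq_relabel _ _ F) => //; exact: attach_complex.
  apply/setP => S; apply/idP/imsetP => [SA|[T TA ->]]; last first.
    move: TA; rewrite !inE !FE; case: ifP => _ /=.
      by move=> /andP[/eqP -> ->]; rewrite imset0 eqxx.
    case/orP => /andP[] => [-> lT|lT ->]; first by rewrite imset_f.
    by rewrite -imset_set1 imsetS ?orbT.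
  suff [A lA AP] : exists2 A : {set V}, lpart S = f @: A &
      triple (pole \in S) A (rpart S) \in attach D w L.
    by exists (triple (pole \in S) A (rpart S)) => //; apply: parts_eq;
      rewrite !FE ?pole_triple ?lpart_triple ?rpart_triple.
  move: SA; rewrite !inE; case: ifP => pS.
    move=> /andP[/eqP l0 rL]; exists set0; first by rewrite imset0.
    by rewrite inE pole_triple lpart_triple rpart_triple eqxx.
  case/orP => /andP[].
    move=> r0 /imsetP[A AD ->]; exists A => //.
    by rewrite inE pole_triple lpart_triple rpart_triple r0 AD.
  rewrite subset1 => /orP[] /eqP -> rL; [exists [set w]|exists set0];
    rewrite ?imset_set1 ?imset0 //;
    by rewrite inE pole_triple lpart_triple rpart_triple rL ?sub0set ?subxx orbT.
Qed.

(** Both poles are joined to every face of [L], so a collapse of [L] along [tau] with apex [p] stays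
    a collapse after suspension. The base vertex of the result is always [w], so a slide in [L]
    becomes trivial. *)
Lemma peq_attachr V (D : {set {set V}}) w W W' (L : {set {set W}}) y
    (L' : {set {set W'}}) y' : is_complex D -> peq L y L' y' ->
  peq (attach D w L) (inl w) (attach D w L') (inl w).
Proof.
move=> cD; elim=> {W W' L y L' y'}.
- by move=> W L y cL; apply: peq_refl; exact: attach_complex.
- by move=> W W' L y L' y' _; exact: peq_sym.
- by move=> U W W' J u K v M x _ + _; exact: peq_trans.
- move=> W L tau p y cL tau0 _ ptau Lcone.
  pose tau' : {set V + option W} := (inr \o some) @: tau.
  have tauE (S : {set V + option W}) : (tau' \subset S) = (tau \subset rpart S).
    by rewrite subset_parts !partsE sub0set.
  have -> : attach D w (collapse L tau) = collapse (attach D w L) tau'.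
    apply/setP => S; rewrite !inE tauE; case: ifP => _; first by rewrite andbA.
    have [-> /=|_ /=] := eqVneq (rpart S) set0; last by rewrite andbA.
    by rewrite subset0 tau0 !andbT.
  apply: (@peq_collapse _ _ _ (inr (Some p))).
  + exact: attach_complex.
  + by rewrite -subset0 tauE !partsE subset0.
  + apply: contra tau0 => /eqP e; have := congr1 rpart e.
    by rewrite !partsE => ->.
  + by rewrite (mem_imset (f := inr \o some)) // => ? ? [].
  + move=> S; rewrite tauE !inE !partsE orFb set0U => + tS.
    have rS0 : rpart S != set0 by apply: contra tau0 => /eqP r0; rewrite -subset0 -r0.
    by rewrite (negPf rS0) /=; case: ifP => _ /andP[-> /Lcone->//]; rewrite orbT.
- by move=> W L y x cL _; apply: peq_refl; exact: attach_complex.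
- move=> W W' f L y cL finj.
  pose F (z : V + option W) : V + option W' :=
    match z with inl x => inl x | inr z => inr (omap f z) end.
  have Finj : injective F.
    by move=> [x|[y'|]] [x'|[y''|]] //= [] => [->|/finj ->].
  have FE (S : {set V + option W}) : (lpart (F @: S) = lpart S) *
      (rpart (F @: S) = f @: rpart S) * ((pole \in F @: S) = (pole \in S)).
    do !split.
    + by apply/setP => x; rewrite !inE (mem_imset _ (inl x)).
    + apply/setP => x; rewrite inE; apply/imsetP/imsetP => [[[z|[z|]] zS //= [->]]|[z zS ->]].
        by exists z; rewrite ?inE.
      by exists (inr (Some z)) => //; rewrite inE in zS.
    + by rewrite (mem_imset _ pole).
  suff -> : attach D w (relabel f L) = relabel F (attach D w L).
    by apply: (@peq_relabel _ _ F) => //; exact: attach_complex.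
  apply/setP => S; apply/idP/imsetP => [SA|[T TA ->]]; last first.
    move: TA; rewrite !inE !FE; case: ifP => _ /=.
      by move=> /andP[-> rT]; rewrite imset_f.
    case/orP => /andP[] => [/eqP -> ->|-> rT]; first by rewrite imset0 eqxx.
    by rewrite imset_f ?orbT.
  suff [A rA AP] : exists2 A : {set W}, rpart S = f @: A &
      triple (pole \in S) (lpart S) A \in attach D w L.
    by exists (triple (pole \in S) (lpart S) A) => //; apply: parts_eq;
      rewrite !FE ?pole_triple ?lpart_triple ?rpart_triple.
  move: SA; rewrite !inE; case: ifP => pS.
    move=> /andP[/eqP l0 /imsetP[A AL ->]]; exists A => //.
    by rewrite inE pole_triple lpart_triple rpart_triple l0 eqxx.
  case/orP => /andP[].
    move=> /eqP -> lD; exists set0; first by rewrite imset0.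
    by rewrite inE pole_triple lpart_triple rpart_triple eqxx lD.
  move=> lw /imsetP[A AL ->]; exists A => //.
  by rewrite inE pole_triple lpart_triple rpart_triple lw AL orbT.
Qed.

(** * Deletion and link of a vertex *)

Definition deletion V (K : {set {set V}}) (v : V) := [set A in K | v \notin A].
Definition link V (K : {set {set V}}) (v : V) :=
  [set A in K | (v \notin A) && (v |: A \in K)].

Lemma deletion_complex V (K : {set {set V}}) v :
  is_complex K -> is_complex (deletion K v).
Proof.
move=> [K0 Kdown]; split=> [|A B AB]; first by rewrite !inE K0.
rewrite !inE => /andP[/(Kdown _ _ AB) ->].
by apply: contra; exact: (subsetP AB).
Qed.

Lemma link_complex V (K : {set {set V}}) v :
  is_complex K -> [set v] \in K -> is_complex (link K v).
Proof.
move=> [K0 Kdown] vK; split=> [|A B AB]; first by rewrite !inE K0 setU0.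
rewrite !inE => /and3P[/(Kdown _ _ AB) -> vB vBK] /=; apply/andP; split.
  by apply: contra vB; exact: (subsetP AB).
by apply: Kdown vBK; exact: setUS.
Qed.

(* Since the link of [v] lies in a cone of the deletion, [v * link] may be slid
   off the deletion.  Doubling the link into [L] and its copy [L'] interpolates:
   the cones over the prism between [L] and [L'] with apices [v] and [w] are
   added first, and then collapsed onto the cones over [L']. *)
Lemma peq_detach V (K : {set {set V}}) (v w : V) :
  is_complex K -> [set v] \in K -> [set w] \in deletion K v ->
  (forall A, A \in link K v -> w |: A \in deletion K v) ->
  peq K w (attach (deletion K v) w (link K v)) (inl w).
Proof.
move=> cK vK wD LwD; have cD := deletion_complex v cK.
have cL := link_complex cK vK.
set D := deletion K v in wD LwD cD *; set L := link K v in LwD cL *.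
have [K0 Kdown] := cK; have [D0 Ddown] := cD; have [L0 Ldown] := cL.
have wv : w != v by move: wD; rewrite !inE => /andP[_]; rewrite eq_sym.
(* A copy of [K] in the vertex set of the glued complex, with [v] in the place of the new pole. *)
pose f (x : V) : V + option V := if x == v then inr None else inl x.
have finj : injective f.
  by move=> x y; rewrite /f; do 2!case: eqVneq => // ?; [congruence|case].
pose K1 := [set S : {set V + option V} | (rpart S == set0) &&
  if pole \in S then lpart S \in L else lpart S \in D].
have K1E : relabel f K = K1.
  have fE (A : {set V}) : (lpart (f @: A) = A :\ v) * (rpart (f @: A) = set0) *
      ((pole \in f @: A) = (v \in A)).
    do !split.
    - apply/setP => x; rewrite !inE; apply/imsetP/andP => [[y yA]|[xv xA]].
        by rewrite /f; case: eqVneq => // yv [->].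
      by exists x => //; rewrite /f (negPf xv).
    - by apply/setP => x; rewrite !inE; apply/imsetP => -[y _]; rewrite /f; case: ifP.
    - apply/imsetP/idP => [[y yA]|vA]; first by rewrite /f; case: eqVneq => // <-.
      by exists v => //; rewrite /f eqxx.
  apply/setP => S; apply/imsetP/idP => [[A AK ->]|].
    rewrite inE !fE eqxx /= !inE eqxx /=.
    have AvK : A :\ v \in K by apply: Kdown AK; exact: subsetDl.
    by case: ifP => vA; rewrite AvK //= setD1K.
  rewrite inE => /andP[/eqP r0]; case: ifP => pS; rewrite !inE => lS.
    case/and3P: lS => lK vl vlK; exists (v |: lpart S) => //.
    by apply: parts_eq; rewrite !fE ?setU11 // setU1K // inE.
  case/andP: lS => lK vl; exists (lpart S) => //; apply: parts_eq; rewrite !fE ?r0 //.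
    by rewrite pS inE (negPf vl).
  apply/setP => x; rewrite in_setD1; case: eqVneq => // ->.
  by rewrite inE (negPf vl).
clearbody D L.
(* A set of doubled vertices counts as a face of the prism when the union of its two parts is in
   [L]. [M2] joins both [pole], playing [v], and [w] to this prism; in [M3] the pole is joined to
   the copy of [L] only. *)
pose M2 := [set S : {set V + option V} | if pole \in S
  then lpart S :|: rpart S \in L
  else (rpart S == set0) && (lpart S \in D) ||
       ((lpart S :\ w) :|: rpart S \in L)].
pose M3 := [set S : {set V + option V} | if pole \in S
  then (lpart S == set0) && (rpart S \in L)
  else (rpart S == set0) && (lpart S \in D) ||
       ((lpart S :\ w) :|: rpart S \in L)].
have cM2 : is_complex M2.
  split=> [|S T]; first by rewrite inE !partsE eqxx D0.
  rewrite subset_parts !inE => /and3P[].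
  case: (pole \in T); case: (pole \in S) => //= _ lST rST.
  - by apply: Ldown; exact: setUSS.
  - move=> /Ldown -> //; first by rewrite orbT.
    by apply: setUSS => //; apply: subset_trans lST; exact: subsetDl.
  - case/orP => [/andP[/eqP rT lT]|h].
      by rewrite -subset0 -rT rST (Ddown _ _ lST lT).
    by rewrite (Ldown _ _ _ h) ?orbT // setUSS // setSD.
have cM3 : is_complex M3.
  split=> [|S T]; first by rewrite inE !partsE eqxx D0.
  rewrite subset_parts !inE => /and3P[].
  case: (pole \in T); case: (pole \in S) => //= _ lST rST.
  - by move=> /andP[/eqP lT /Ldown ->//]; rewrite -subset0 -lT lST.
  - move=> /andP[/eqP lT /Ldown -> //]; first by rewrite orbT.
    by rewrite subUset rST (subset_trans (subsetDl _ _)) ?(subset_trans lST) ?lT ?sub0set.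
  - case/orP => [/andP[/eqP rT lT]|h].
      by rewrite -subset0 -rT rST (Ddown _ _ lST lT).
    by rewrite (Ldown _ _ _ h) ?orbT // setUSS // setSD.
have K_K1 : peq K w K1 (inl w).
  by rewrite -K1E; have := peq_relabel w cK finj; rewrite /f (negPf wv).
apply: (peq_trans K_K1); apply: (@peq_trans _ _ _ _ _ M2 (inl w)).
  apply: peq_sym.
  (* A face with the copy of a vertex may be enlarged by the original, since the union of its parts
     does not grow: removing all copies leads back to [K1]. *)
  apply: (@peq_collapses _ V _ _ (fun x => [set inr (Some x)]) (fun x => inl x)) => //.
  - by move=> x; apply/set0Pn; exists (inr (Some x)); rewrite inE.
  - by move=> x; apply/eqP => /setP/(_ (inl w)); rewrite !inE eqxx.
  - by move=> x y; rewrite inE.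
  - move=> x S; rewrite sub1set !inE !partsE /= => + xS.
    have {}xS : x \in rpart S by rewrite inE.
    rewrite set0U.
    have eU : x |: lpart S :|: rpart S = lpart S :|: rpart S.
      by rewrite -setUA; apply/setUidPr; rewrite sub1set in_setU xS orbT.
    case: ifP => _; first by rewrite eU.
    case/orP => [/andP[/eqP r0]|]; first by rewrite r0 inE in xS.
    move=> h; apply/orP; right; apply: Ldown h.
    apply/subsetP => z; rewrite !inE => /orP[/andP[-> /orP[/eqP ->|->//]]|->];
      last by rewrite orbT.
    by rewrite inE in xS; rewrite xS orbT.
  - move=> S; have -> : [forall x, ~~ ([set inr (Some x)] \subset S)] = (rpart S == set0).
      apply/forallP/eqP => [h|r0 x].
        by apply/setP => x; have := h x; rewrite sub1set !inE => /negPf.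
      by have /setP/(_ x) := r0; rewrite !inE sub1set => ->.
    rewrite !inE andbC; have [->/=|] := eqVneq (rpart S) set0; last by rewrite !andbF.
    rewrite !setU0 !andbT; case: ifP => // _; apply/idP/orP => [|[//|/LwD]]; first by left.
    by apply: Ddown; rewrite -subDset setDE; apply/subsetP => z; rewrite !inE andbC.
apply: (@peq_trans _ _ _ _ _ M3 (inl w)).
  (* The edges from the pole to the originals are removed, the copy of the same vertex being the
     apex. *)
  apply: (@peq_collapses _ V _ _ (fun x => [set pole; inl x]) (fun x => inr (Some x))) => //.
  - by move=> x; apply/set0Pn; exists pole; rewrite !inE.
  - by move=> x; apply/eqP => /setP/(_ pole); rewrite !inE.
  - by move=> x y; rewrite !inE.
  - move=> x S; rewrite subUset !sub1set !inE !partsE /= => + /andP[pS xS].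
    rewrite pS; apply: Ldown; apply/subsetP => z; rewrite !inE.
    by rewrite orFb => /or3P[->//|/eqP ->|->]; rewrite ?xS ?orbT.
  - move=> S; have -> : [forall x, ~~ ([set pole; inl x] \subset S)] =
        (pole \notin S) || (lpart S == set0).
      apply/forallP/orP => [h|[pS x|/eqP l0 x]].
      - have [pS|] := boolP (pole \in S); [right|by left].
        by apply/eqP/setP => x; have := h x; rewrite subUset !sub1set pS !inE => /negPf.
      - by rewrite subUset !sub1set (negPf pS).
      - by have /setP/(_ x) := l0; rewrite subUset !sub1set !inE => ->; rewrite andbF.
    rewrite !inE; case: ifP => _ /=; last by rewrite andbT.
    by have [->|] := eqVneq; rewrite ?set0U ?andbT ?andbF.
have cA := attach_complex w cD cL.
(* What [M3] has beyond the target are faces of the cone with apex [w] over the prism that lie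
   neither in [D] nor in the cone over the copy; this set is stable under toggling [w]. *)
apply: (@peq_toggle _ _ _ (inl w)) => //.
- by rewrite inE !partsE eqxx /= wD.
- apply/subsetP => S; rewrite !inE; case: ifP => // _ /orP[->//|/andP[lw rL]].
  by have /eqP -> : lpart S :\ w == set0; rewrite ?set0U ?rL ?orbT // setD_eq0.
move=> S; rewrite !inE !partsE /= setD0 set0U /=.
have -> : (w |: lpart S) :\ w = lpart S :\ w.
  by apply/setP => x; rewrite !inE; case: eqVneq.
case: ifP => [_ ->//|_ /=]; case/orP => [->//|h]; rewrite h orbT /= !negb_or.
have rL : rpart S \in L by apply: Ldown h; exact: subsetUr.
rewrite rL !andbT; case/andP => nD lw; apply/andP; split; last first.
  by rewrite subDset setUid.
apply: contra nD => /andP[r0 _]; rewrite r0; move: h; rewrite (eqP r0) setU0 => /LwD.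
by apply: Ddown; rewrite -subDset.
Qed.

(** * Complexes in normal form *)

Definition standard V (X : {set {set V}}) (x : V) :=
  [/\ is_complex X, [set x] \in X &
      forall A B, A \in X -> x |: A \notin X -> B \in X -> A \subset B -> B = A].

Definition good V (K : {set {set V}}) (w : V) :=
  exists (U : finType) (X : {set {set U}}) (x : U), peq K w X x /\ standard X x.

Definition good_or_empty V (K : {set {set V}}) :=
  K = [set set0] \/ exists w, good K w.

Lemma peq_good V W (K : {set {set V}}) w (L : {set {set W}}) x :
  peq K w L x -> good L x -> good K w.
Proof. by move=> KL [U [X [u [LX sX]]]]; exists U, X, u; split=> //; exact: peq_trans LX. Qed.

Lemma standard_good V (K : {set {set V}}) w : standard K w -> good K w.
Proof. by move=> sK; exists V, K, w; split=> //; apply: peq_refl; case: sK. Qed.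

Lemma set0_complex V : is_complex [set set0 : {set V}].
Proof. by split=> [|A B AB]; rewrite !inE // => /eqP B0; rewrite -subset0 -B0. Qed.

(** The suspension of the empty complex adds the pole as an isolated vertex, a further facet with
    empty boundary that will contribute a 0-sphere. *)
Lemma attach0_standard V W (X : {set {set V}}) x :
  standard X x -> standard (attach X x [set set0 : {set W}]) (inl x).
Proof.
move=> [cX xX Xfacet]; have [X0 Xdown] := cX; split.
- by apply: attach_complex => //; exact: set0_complex.
- by rewrite inE !partsE eqxx xX.
have mem (S : {set V + option W}) : (S \in attach X x [set set0]) =
    (rpart S == set0) && if pole \in S then lpart S == set0 else lpart S \in X.
  rewrite !inE andbC; case: ifP => // _; rewrite [X in _ || X]andbC -andb_orr; congr (_ && _).
  by apply/orP/idP => [[//|/Xdown]|]; [exact|left].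
move=> S T; rewrite !mem !partsE /= set0U => /andP[/eqP rS]; rewrite rS eqxx /=.
rewrite subset_parts; case: ifP => pS lS xS /andP[/eqP rT] + /and3P[+ lST _] /=.
  case: ifP => pT // /eqP lT _; apply: parts_eq; rewrite ?pS ?pT ?rS ?rT //.
  by rewrite lT (eqP lS).
case: ifP => pT lT _; last by apply: parts_eq; rewrite ?pS ?pT ?rS ?rT //; exact: Xfacet lST.
by move: lST xS; rewrite (eqP lT) subset0 => /eqP ->; rewrite setU0 xX.
Qed.

(** The suspension of [Y] is filled in until the star of [x] is large enough: in [Q] the vertex [x]
    is joined to the cone over [Y] with apex [y], and in [Z] also to the join of the pole with the
    star of [y]. The faces of [Z] outside the star of [x] are then the further facets of [X], and
    the further facets of [Y] with the pole added; the spheres of [Y] gain one dimension. *)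
Lemma attach_good V W (X : {set {set V}}) x (Y : {set {set W}}) y :
  standard X x -> standard Y y -> good (attach X x Y) (inl x).
Proof.
move=> [cX xX Xfacet] [cY yY Yfacet]; have [X0 Xdown] := cX; have [Y0 Ydown] := cY.
have DY (B : {set W}) : B \in Y -> B :\ y \in Y by apply: Ydown; exact: subsetDl.
have UY (B : {set W}) : y |: B \in Y -> B \in Y by apply: Ydown; exact: subsetUr.
pose Q := [set S : {set V + option W} | if pole \in S
  then (lpart S == set0) && (rpart S \in Y)
  else (rpart S == set0) && (lpart S \in X) ||
       (lpart S \subset [set x]) && (rpart S :\ y \in Y)].
pose Z := [set S : {set V + option W} | if pole \in S
  then (lpart S == set0) && (rpart S \in Y) ||
       (lpart S \subset [set x]) && (y |: rpart S \in Y)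
  else (rpart S == set0) && (lpart S \in X) ||
       (lpart S \subset [set x]) && (rpart S :\ y \in Y)].
have cZ : is_complex Z.
  split=> [|S T]; first by rewrite inE !partsE eqxx X0.
  rewrite subset_parts !inE => /and3P[].
  case: (pole \in T); case: (pole \in S) => //= _ lST rST.
  - case/orP => /andP[lT rT].
      by rewrite (Ydown _ _ rST rT) -subset0 (subset_trans lST) // subset0.
    by rewrite (subset_trans lST lT) (Ydown _ _ (setUS _ rST) rT) orbT.
  - case/orP => /andP[lT rT].
      rewrite (DY _ (Ydown _ _ rST rT)) (subset_trans lST) ?orbT //.
      by rewrite (eqP lT) sub0set.
    by rewrite (subset_trans lST lT) (DY _ (Ydown _ _ rST (UY _ rT))) orbT.
  - case/orP => /andP[].
      by move=> /eqP rT /(Xdown _ _ lST) ->; rewrite -subset0 -rT rST.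
    by move=> lT /(Ydown _ _ (setSD _ rST)) ->; rewrite (subset_trans lST lT) orbT.
have cQ : is_complex Q.
  split=> [|S T]; first by rewrite inE !partsE eqxx X0.
  rewrite subset_parts !inE => /and3P[].
  case: (pole \in T); case: (pole \in S) => //= _ lST rST.
  - case/andP => lT rT.
    by rewrite (Ydown _ _ rST rT) -subset0 (subset_trans lST) // subset0.
  - case/andP => lT rT.
    rewrite (DY _ (Ydown _ _ rST rT)) (subset_trans lST) ?orbT //.
    by rewrite (eqP lT) sub0set.
  - case/orP => /andP[].
      by move=> /eqP rT /(Xdown _ _ lST) ->; rewrite -subset0 -rT rST.
    by move=> lT /(Ydown _ _ (setSD _ rST)) ->; rewrite (subset_trans lST lT) orbT.
have cA := attach_complex x cX cY.
apply: (@peq_good _ _ _ _ Q (inl x)).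
  apply: peq_sym; apply: (@peq_toggle _ _ _ (inl x)) => //.
  - by rewrite inE !partsE eqxx xX.
  - apply/subsetP => S; rewrite !inE; case: ifP => // _ /orP[->//|/andP[-> /DY->]].
    by rewrite orbT.
  move=> S; rewrite !inE !partsE /= set0U setD0.
  case: ifP => _; first by move=> ->.
  rewrite !negb_or => + /andP[nX nY]; rewrite (negPf nX) /= => /andP[lS rS].
  have rY : rpart S \notin Y by apply: contra nY => ->; rewrite lS.
  rewrite subUset subxx lS rS orbT (negPf rY) andbF andbT /=.
  by apply: contra rY => /andP[/eqP -> _].
apply: (@peq_good _ _ _ _ Z (inl x)).
  apply: peq_sym; apply: (@peq_toggle _ _ _ (inr (Some y))) => //.
  - by rewrite inE !partsE eqxx xX.
  - by apply/subsetP => S; rewrite !inE; case: ifP => // _ ->.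
  move=> S; rewrite !inE !partsE /= set0U setD0.
  case: ifP => [_|_ ->//]; case/orP => [->//|/andP[lS rS]].
  rewrite (UY _ rS) andbT => l0; rewrite (negPf l0) lS /=.
  by rewrite setUA setUid rS.
apply: standard_good; split=> //; first by rewrite inE !partsE eqxx xX.
move=> S T; rewrite !inE !partsE /= set0U subUset subxx subset_parts /=.
case: ifP => pS /=.
  case/orP => /andP[lS rS]; last by rewrite lS rS orbT.
  rewrite negb_or => /andP[_]; rewrite (eqP lS) sub0set /= => yS.
  case: ifP => // pT /orP[] /andP[lT rT] /and3P[_ lST rST]; last first.
    by case/negP: yS; apply: Ydown rT; exact: setUS.
  apply: parts_eq; rewrite ?pS ?pT ?(eqP lS) ?(eqP lT) //.
  exact: Yfacet rST.
case/orP => /andP[]; last by move=> -> ->; rewrite orbT.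
move=> /eqP rS lS; rewrite rS eqxx /= negb_or => /andP[xS _].
have nlx : ~~ (lpart S \subset [set x]).
  by apply: contra xS => /setUidPl ->.
move=> TZ /andP[lST rST].
have nlT : ~~ (lpart T \subset [set x]).
  by apply: contra nlx; exact: subset_trans.
move: TZ; rewrite (negPf nlT) orbF; case: ifP => pT /=.
  by move=> /andP[/eqP lT]; rewrite lT sub0set in nlT.
rewrite orbF => /andP[/eqP rT lT]; apply: parts_eq; rewrite ?pS ?pT ?rS ?rT //.
exact: Xfacet lST.
Qed.

(* The inductive step: up to homotopy, [K] is the wedge of the deletion of [v]
   and of the suspension of its link. *)
Lemma good_deletion_link V (K : {set {set V}}) (v w : V) :
  is_complex K -> [set v] \in K -> [set w] \in deletion K v ->
  (forall A, A \in link K v -> w |: A \in deletion K v) ->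
  good (deletion K v) w -> good_or_empty (link K v) -> good K w.
Proof.
move=> cK vK wD LwD gD gL; apply: peq_good (peq_detach cK vK wD LwD) _.
have cL := link_complex cK vK; have cD := deletion_complex v cK.
case: gD => U [X [x [DX sX]]]; have [cX _ _] := sX.
apply: peq_good (peq_attachl cL DX) _.
case: gL => [->|[y [U' [Y [y' [LY sY]]]]]].
  by apply: standard_good; exact: attach0_standard.
exact: peq_good (peq_attachr x cX LY) (attach_good sX sY).
Qed.

(** * Faces as words *)

Section Words.
(** [n] is the number of letters, [R] the total number of blocks, and [al j m] allows letter [j] to
    stand after [m] blocks. *)
Variables (t n R : nat) (al : nat -> nat -> bool).
Hypothesis t_gt0 : 0 < t.
Hypothesis al_up : forall j m m', al j m -> m <= m' <= R -> al j m'.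
Hypothesis al_down : forall j j' m, al j m -> j' <= j -> al j' m.
Hypothesis al_max : forall j, j < n -> al j R.

Let N := R * t + n.

Definition heights i c (m : nat -> nat) :=
  (forall j, i <= j < n -> c <= m j <= R /\ al j (m j)) /\
  (forall j j', i <= j -> j <= j' < n -> m j <= m j').

Definition covers i (m : nat -> nat) (s : nat) :=
  exists2 j, i <= j < n & s = m j * t + j.

(* The faces of the complex of words in which the letters [i], ..., [n.-1] are
   still to be placed after [c] blocks of length [t], with the first [k]
   positions deleted; the letter [j] preceded by [m j] blocks has position
   [m j * t + j]. *)
Definition word_faces i c k : {set {set 'I_N}} :=
  [set S : {set 'I_N} | `[< exists2 m, heights i c m &
     forall s : 'I_N, s \in S -> c * t + i + k <= s /\ covers i m s >] ].

Lemma word_facesP i c k (S : {set 'I_N}) : reflect (exists2 m, heights i c m &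
  forall s : 'I_N, s \in S -> c * t + i + k <= s /\ covers i m s)
  (S \in word_faces i c k).
Proof. by rewrite inE; exact: asboolP. Qed.

Lemma heights_eq i c m j : heights i c m -> i <= j < n ->
  m j * t + j < c.+1 * t + i -> m j = c.
Proof.
move=> [m1 _] jn lt_j; have [/andP[cm _] _] := m1 _ jn.
by case: (ltnP c (m j)) => [mc|]; [have := leq_mul mc (leqnn t)|]; lia.
Qed.

Lemma word_faces_complex i c k : c <= R -> is_complex (word_faces i c k).
Proof.
move=> cR; split=> [|A B /subsetP AB /word_facesP[m hm mB]].
  apply/word_facesP; exists (fun=> R) => [|s]; last by rewrite inE.
  by split=> // j /andP[_ jn]; rewrite cR leqnn; split=> //; exact: al_max.
by apply/word_facesP; exists m => // s /AB; exact: mB.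
Qed.

Lemma word_faces_step i c k : k <= t ->
  word_faces i c.+1 0 \subset word_faces i c k.
Proof.
move=> kt; apply/subsetP => S /word_facesP[m [m1 m2] mS]; apply/word_facesP.
exists m; first split=> // j /m1 [/andP[cm ->] ->].
  by rewrite (ltnW cm).
by move=> s /mS[+ ?]; rewrite mulSn => h; split=> //; lia.
Qed.

(* If no element of [S] is among the next [t] positions, then the next block can
   be moved to the front. *)
Lemma word_faces_swap i c m (S : {set 'I_N}) : c < R -> heights i c m ->
  (forall s : 'I_N, s \in S -> c.+1 * t + i <= s /\ covers i m s) ->
  S \in word_faces i c.+1 0 /\
  (i < n -> m i = c -> forall w : 'I_N, w = c.+1 * t + i :> nat ->
     w |: S \in word_faces i c.+1 0).
Proof.
move=> cR [m1 m2] mS; pose m' j := maxn c.+1 (m j).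
have hm' : heights i c.+1 m'.
  split=> [j jn|j j' ij jj']; last first.
    by have := m2 _ _ ij jj'; rewrite /m'; lia.
  have [mR alm] := m1 _ jn; split; first by rewrite /m'; lia.
  by apply: al_up alm _; rewrite /m'; lia.
have m'S (s : 'I_N) : s \in S -> c.+1 * t + i + 0 <= s /\ covers i m' s.
  move=> /mS[cs [j jn sE]]; split; first by rewrite addn0.
  have [cm|mc] := ltnP c (m j); first by exists j => //; rewrite sE /m' (maxn_idPr _).
  have [cm _] := m1 _ jn.
  have mE : m j = c by lia.
  rewrite mE mulSn in sE cs.
  (* Position [c * t + j] is also that of letter [j - t] after one more block. *)
  exists (j - t); first lia.
  have : m (j - t) <= m j by apply: m2; lia.
  by rewrite /m' mE => h; rewrite (maxn_idPl _) ?mulSn; lia.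
split; first by apply/word_facesP; exists m'.
move=> i_n mi w wE; apply/word_facesP; exists m' => // s.
rewrite in_setU1 => /predU1P[->|/m'S//].
rewrite wE addn0; split=> //; exists i; first by rewrite leqnn.
by rewrite /m' mi (maxn_idPl _).
Qed.

(** In each case no face has an element before [c.+1 * t + i], so that [word_faces_swap] applies.
    Such an element would belong to a letter of index at least [i + k] after only [c] blocks; but
    the deletions have exhausted the block, or the letters, or that letter is forbidden by
    [al_down]. *)
Lemma word_faces_skip i c k : c < R -> k <= t ->
  [|| k == t, n <= i + k | ~~ al (i + k) c] ->
  word_faces i c k = word_faces i c.+1 0.
Proof.
move=> cR kt h; apply/eqP; rewrite eqEsubset word_faces_step // andbT.
apply/subsetP => S /word_facesP[m hm mS].
apply: (word_faces_swap cR hm _).1 => s /mS[cs [j jn sE]]; split; last by exists j.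
have [mR alm] := hm.1 _ jn.
have [cm|mc] := ltnP c (m j).
  by have := leq_mul cm (leqnn t); lia.
have mE : m j = c by lia.
rewrite mE in sE alm; rewrite mulSn.
case/or3P: h => [/eqP|nik|/negP[]]; [lia|lia|].
by apply: al_down alm _; lia.
Qed.

(** After all [R] blocks the word is determined, so the remaining positions span a full simplex. *)
Lemma word_faces_last i k (S : {set 'I_N}) : (S \in word_faces i R k) =
  [forall s in S, R * t + i + k <= s].
Proof.
apply/word_facesP/forall_inP => [[m _ mS] s /mS[]//|RS].
exists (fun=> R) => [|s sS].
  by split=> // j /andP[_ jn]; rewrite leqnn; split=> //; exact: al_max.
split; first exact: RS.
by exists (s - R * t); have := RS _ sS; have := ltn_ord s; rewrite /N; lia.
Qed.

Lemma word_faces_nil i c k (S : {set 'I_N}) : n <= i -> S \in word_faces i c k -> S = set0.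
Proof.
move=> ni /word_facesP[m _ mS]; apply/setP => s; rewrite inE; apply/negP => /mS[_ [j]].
by lia.
Qed.

Lemma word_faces_last_standard i k (x : 'I_N) : x = R * t + i + k :> nat ->
  standard (word_faces i R k) x.
Proof.
move=> xE; split; first exact: word_faces_complex.
- by rewrite word_faces_last; apply/forall_inP => s; rewrite inE => /eqP ->; rewrite xE.
- move=> A B; rewrite !word_faces_last => /forall_inP hA /forall_inP[] s.
  by rewrite in_setU1 => /predU1P[->|/hA//]; rewrite xE.
Qed.

(** Letters up to [j0] are put at height [m0] and all later ones at the maximal height [R]. Taking
    [y = x] gives vertices; the other alternative gives the edges along which base vertices
    slide. *)
Lemma word_faces2 i c k j0 m0 j1 (x y : 'I_N) : i <= j0 -> j0 < n ->
  c <= m0 <= R -> al j0 m0 -> x = m0 * t + j0 :> nat ->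
  y = x \/ j0 < j1 < n /\ y = R * t + j1 :> nat -> c * t + i + k <= x ->
  [set x; y] \in word_faces i c k.
Proof.
move=> ij0 j0n cm0 al0 xE xy cx; apply/word_facesP.
exists (fun j => if j <= j0 then m0 else R).
  split=> [j jn|j j' ij jj']; last by case: (leqP j j0); case: (leqP j' j0); lia.
  case: (leqP j j0) => jj0; split; [lia|exact: al_down al0 _|lia|].
  by apply: al_max; lia.
have cx' : c * t + i + k <= x /\ covers i (fun j => if j <= j0 then m0 else R) x.
  by split=> //; exists j0; rewrite ?leqnn // ij0.
move=> s; rewrite !inE => /orP[] /eqP -> //.
case: xy => [->//|[j1n yE]]; split.
  by rewrite yE; have := leq_mul (proj2 (andP cm0)) (leqnn t); lia.
by exists j1; [lia|case: (leqP j1 j0); lia].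
Qed.

Lemma word_faces_branch i c k (w : 'I_N) : c < R -> k < t -> i + k < n ->
  al (i + k) c -> w = c.+1 * t + i :> nat -> good (word_faces i c.+1 0) w ->
  good_or_empty (word_faces (i + k).+1 c (t - k.+1)) ->
  good (word_faces i c k) w.
Proof.
move=> cR kt ikn alik wE gD gL; set K := word_faces i c k.
have cK : is_complex K by apply: word_faces_complex; exact: ltnW.
have cRt : c.+1 * t <= R * t by rewrite leq_mul2r cR orbT.
have vN : c * t + (i + k) < N by rewrite /N; move: cRt; rewrite mulSn; lia.
pose v := Ordinal vN.
(* After [k] deletions [v] is the first position left, and these are the positions between [v] and
   [w]. In a face containing one of them its letter has height [c], which by monotonicity forces
   letter [i + k] to height [c] too: the face may be enlarged by [v]. *)
pose I : finType := {u : 'I_N | v < u < c.+1 * t + i}.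
have IP (u : I) : c * t + (i + k) < val u < c.+1 * t + i by exact: (valP u).
pose K' := [set A in K | [forall u : I, ~~ ([set val u] \subset A)]].
have K'P A : A \in K' -> A \in K /\ forall s, s \in A -> s <= v \/ c.+1 * t + i <= s.
  rewrite inE => /andP[AK /forallP h]; split=> // s sA.
  case: (leqP s v) => [|vs]; [by left|].
  case: (leqP (c.+1 * t + i) s) => [|sc]; [by right|].
  have sI : v < s < c.+1 * t + i by rewrite vs.
  by have := h (Sub s sI); rewrite SubK sub1set sA.
have inK' A : A \in K -> (forall s, s \in A -> s <= v \/ c.+1 * t + i <= s) -> A \in K'.
  move=> AK h; rewrite inE AK; apply/forallP => u; rewrite sub1set; apply/negP => /h.
  by have := IP u; rewrite /=; lia.
have KK' : peq K w K' w.
  apply: (@peq_collapses _ I _ _ (fun u => [set val u]) (fun=> v)) => //.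
  - by move=> u; apply/set0Pn; exists (val u); rewrite inE.
  - move=> u; apply/eqP => /setP/(_ w); rewrite !inE eqxx => /eqP uw.
    by have := IP u; rewrite -uw wE ltnn andbF.
  - by move=> _ u; rewrite inE; apply/eqP => uv; have := IP u; rewrite -uv ltnn.
  - move=> u A /word_facesP[m hm mA]; rewrite sub1set => uA.
    have [m1 m2] := hm; have [cu [j jn uE]] := mA _ uA; have vu := IP u.
    have mE : m j = c by apply: (heights_eq hm jn); rewrite -uE; lia.
    rewrite mE in uE.
    have mik : m (i + k) = c.
      have ik : i <= i + k < n by lia.
      have [+ _] := m1 _ ik; have : m (i + k) <= m j by apply: m2; lia.
      by rewrite mE; lia.
    apply/word_facesP; exists m => // s; rewrite in_setU1 => /predU1P[->|/mA//].
    by split=> /=; [lia|exists (i + k); rewrite ?mik; lia].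
  - by move=> A; rewrite inE.
apply: (peq_good KK'); have cK' : is_complex K' by case: (peq_complex KK').
have DE : deletion K' v = word_faces i c.+1 0.
  apply/setP => A; apply/idP/idP => [|AD].
    rewrite inE => /andP[/K'P[/word_facesP[m hm mA] hA] vA].
    apply: (word_faces_swap cR hm _).1 => s sA; have [cs ms] := mA _ sA.
    split=> //; case: (hA _ sA) => // sv.
    have sE : s = v by apply: val_inj => /=; move: sv => /=; lia.
    by rewrite -sE sA in vA.
  have h s : s \in A -> c.+1 * t + i <= s.
    by move: AD => /word_facesP[m _ mA] /mA[]; rewrite addn0.
  rewrite inE inK' ?(subsetP (word_faces_step _ _ (ltnW kt))) //=.
    by apply/negP => /h /=; rewrite mulSn; lia.
  by move=> s /h; right.
(* A face through [v] has the letters [i], ..., [i + k] at height [c], so the letters from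
   [(i + k).+1] on remain. All positions between [v] and [w] being gone, the number of deletions is
   now [t - k.+1]. *)
have LE : link K' v = word_faces (i + k).+1 c (t - k.+1).
  apply/setP => A; apply/idP/idP => [|AL].
    rewrite inE => /and3P[/K'P[_ hA] vA /K'P[/word_facesP[m hm mA] _]].
    have [m1 m2] := hm; have [_ [j jn /= vE]] := mA _ (setU11 v A).
    have mE : m j = c by apply: (heights_eq hm jn); rewrite -vE mulSn; lia.
    have jE : j = i + k by rewrite mE in vE; lia.
    apply/word_facesP; exists m.
      by split=> [l ln|l l' il ll']; [apply: m1|apply: m2]; lia.
    move=> s sA; have svA : s \in v |: A by rewrite in_setU1 sA orbT.
    have [cs [l ln sE]] := mA _ svA.
    have cs' : c.+1 * t + i <= s.
      case: (hA _ sA) => // sv.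
      have sE' : s = v by apply: val_inj => /=; move: sv => /=; lia.
      by rewrite -sE' sA in vA.
    split; first by move: cs'; rewrite mulSn; lia.
    exists l => //; have [lj|] := leqP l (i + k); last lia.
    have : m l <= m j by apply: m2; lia.
    have [+ _] := m1 _ ln; rewrite mE => h1 h2.
    have ml : m l = c by lia.
    by move: sE cs'; rewrite ml mulSn; lia.
  move: AL => /word_facesP[m [m1 m2] mA].
  have hA s : s \in A -> c.+1 * t + i <= s.
    by move=> /mA[]; rewrite mulSn; lia.
  have vA : v \notin A by apply/negP => /hA /=; rewrite mulSn; lia.
  have vAK : v |: A \in K.
    apply/word_facesP; exists (fun j => if j <= i + k then c else m j).
      split=> [j jn|j j' ij jj'].
        case: (leqP j (i + k)) => jik; first by split; [lia|exact: al_down alik _].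
        by apply: m1; lia.
      case: (leqP j (i + k)) => jik; case: (leqP j' (i + k)) => jik' //; try lia.
        by have [|] := m1 j'; lia.
      by apply: m2; lia.
    move=> s; rewrite in_setU1 => /predU1P[->|sA] /=.
      by split; [lia|exists (i + k); rewrite ?leqnn; lia].
    have := hA _ sA; rewrite mulSn => ?; split; first lia.
    have [_ [j jn sE]] := mA _ sA; exists j; first lia.
    by case: (leqP j (i + k)); lia.
  rewrite inE vA /=; apply/andP; split; apply: inK' => //.
  - by case: cK => _; apply; last exact: vAK; exact: subsetUr.
  - by move=> s /hA; right.
  - by move=> s; rewrite in_setU1 => /predU1P[->|/hA]; [left|right].
have alc : al i c by apply: al_down alik _; exact: leq_addr.
have i_n : i < n by lia.
apply: (@good_deletion_link _ _ v w) => //.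
- apply: inK'; last by move=> s; rewrite inE => /eqP ->; left.
  rewrite -[ [set v] ]setUid; apply: (@word_faces2 _ _ _ (i + k) c 0) => //=; try lia.
  by left.
- rewrite DE -[ [set w] ]setUid; apply: (@word_faces2 _ _ _ i c.+1 0) => //=; try lia.
    by apply: al_up alc _; lia.
  by left.
- rewrite LE DE => A AL.
  have : v |: A \in K'.
    by move: AL; rewrite -LE inE => /and3P[].
  move=> /K'P[/word_facesP[m hm mA] _].
  have [m1 m2] := hm; have [_ [j jn /= vE]] := mA _ (setU11 v A).
  have mE : m j = c by apply: (heights_eq hm jn); rewrite -vE mulSn; lia.
  have mi : m i = c.
    have ii : i <= i < n by rewrite leqnn.
    have [+ _] := m1 _ ii; have : m i <= m j by apply: m2; lia.
    by rewrite mE; lia.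
  (* In a face through [v] letter [i] has height [c]; moving the block to the front brings it to
     height [c.+1], that is to position [w]. *)
  apply: (word_faces_swap cR hm _).2 => // s sA.
  have [_ ms] := mA s (setU1r v sA); split=> //.
  by move: AL => /word_facesP[m' _ m'A]; have [+ _] := m'A _ sA; rewrite mulSn; lia.
- by rewrite DE.
- by rewrite LE.
Qed.

(** The induction is on the number of letters and blocks left. Goodness depends on the base vertex:
    the branching step needs the deletion to be good at [w], the position of letter [i] right after
    the next block, which is the first claim for [c.+1]. The second claim serves the link, where any
    base vertex will do. *)
Lemma word_faces_good d : forall i c, i <= n -> c <= R -> (n - i) + (R - c) < d ->
  (forall x : 'I_N, i < n -> al i c -> x = c * t + i :> nat ->
     good (word_faces i c 0) x) /\
  (forall k, k <= t -> good_or_empty (word_faces i c k)).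
Proof.
elim: d => [//|d IH] i c; rewrite leq_eqVlt => /predU1P[-> cR _|i_n].
  split=> [x|k _]; first by rewrite ltnn.
  left; apply/setP => S; rewrite in_set1; apply/idP/eqP => [/word_faces_nil->//|->].
  by case: (word_faces_complex n k cR).
have RtN : R * t + i < N by rewrite /N; lia.
rewrite leq_eqVlt => /predU1P[->|cR] dE.
  split=> [x _ _ xE|k kt].
    by apply: standard_good; apply: word_faces_last_standard; rewrite addn0.
  have [ikn|nik] := ltnP (i + k) n.
    have xN : R * t + i + k < N by rewrite /N; lia.
    right; exists (Ordinal xN); apply: standard_good.
    exact: word_faces_last_standard.
  left; apply/setP => S; rewrite in_set1 word_faces_last.
  apply/forall_inP/eqP => [h|-> s]; last by rewrite inE.
  apply/setP => s; rewrite inE; apply/negP => /h.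
  by have := ltn_ord s; rewrite /N; lia.
have cRt : c.+1 * t <= R * t by rewrite leq_mul2r cR orbT.
have wN : c.+1 * t + i < N by rewrite /N; lia.
pose w := Ordinal wN.
have [A1 B1] : _ /\ _ := IH i c.+1 (ltnW i_n) cR ltac:(lia).
have branch k : k < t -> i + k < n -> al (i + k) c -> good (word_faces i c k) w.
  move=> kt ikn alik; have alc : al i c by apply: al_down alik _; exact: leq_addr.
  apply: word_faces_branch => //; first by apply: A1 => //; apply: al_up alc _; lia.
  have [_ B2] : _ /\ _ := IH (i + k).+1 c ikn (ltnW cR) ltac:(lia).
  by apply: B2; lia.
split=> [x _ alc xE|k kt].
  have cK := word_faces_complex i 0 (ltnW cR).
  have alc1 : al i c.+1 by apply: al_up alc _; lia.
  have [i1n|ni1] := ltnP i.+1 n.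
    have yN : R * t + i.+1 < N by rewrite /N; lia.
    (* The last position of letter [i.+1] forms an edge with [x] as well as with [w], so the base
       vertex slides from [x] to [w] through it. *)
    pose y := Ordinal yN.
    have xy : [set x; y] \in word_faces i c 0.
      by apply: (@word_faces2 _ _ _ i c i.+1) => //; try lia; right; rewrite ltnSn.
    have wy : [set w; y] \in word_faces i c 0.
      by apply: (@word_faces2 _ _ _ i c.+1 i.+1) => //=; lia.
    apply: peq_good (peq_slide cK xy) _.
    apply: peq_good (peq_sym (peq_slide cK wy)) _.
    by apply: branch => //; rewrite addn0.
  (* With one letter left every face has at most one element, so the complex is a finite set of
     points, already in normal form at [x]. *)
  apply: standard_good; split=> //.
    rewrite -[ [set x] ]setUid; apply: (@word_faces2 _ _ _ i c 0) => //; try lia.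
    by left.
  have uniq (S : {set 'I_N}) s s' : S \in word_faces i c 0 -> s \in S -> s' \in S -> s = s'.
    move=> /word_facesP[m _ mS] /mS[_ [j jn sE]] /mS[_ [j' jn' sE']].
    by apply: val_inj; rewrite /= sE sE'; have -> : j = j' by lia.
  move=> A B AK xA BK AB; have [s sA] : exists s, s \in A.
    apply/set0Pn; apply: contra xA => /eqP ->; rewrite setU0.
    rewrite -[ [set x] ]setUid; apply: (@word_faces2 _ _ _ i c 0) => //; try lia.
    by left.
  apply/eqP; rewrite eqEsubset AB andbT; apply/subsetP => z zB.
  by rewrite (uniq _ _ _ BK zB (subsetP AB _ sA)).
case skip: [|| k == t, n <= i + k | ~~ al (i + k) c].
  by rewrite word_faces_skip //; apply: B1.
right; exists w; move/negbT: skip; rewrite !negb_or negbK -ltnNge => /and3P[kt' ? ?].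
by apply: branch => //; rewrite ltn_neqAle kt'.
Qed.
End Words.

From mathcomp Require Import all_order all_algebra finmap.
From mathcomp Require Import all_classical all_reals all_analysis homotopy.
From mathcomp Require Import lra ring.

Import Order.TTheory GRing.Theory Num.Theory numFieldNormedType.Exports.
Local Open Scope classical_set_scope.
Local Open Scope ring_scope.

(** * Homotopy equivalences *)

Lemma continuous_compose (X Y Z : topologicalType) (f : X -> Y) (g : Y -> Z) :
  continuous f -> continuous g -> continuous (fun x => g (f x)).
Proof. by move=> cf cg x; apply: continuous_comp; [exact: cf|exact: cg]. Qed.

Lemma fst_continuous (X Y : topologicalType) : continuous (@fst X Y).
Proof. by move=> x; exact: cvg_fst. Qed.

Lemma snd_continuous (X Y : topologicalType) : continuous (@snd X Y).
Proof. by move=> x; exact: cvg_snd. Qed.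

Section RealValued.
Context {R : realType} {T : topologicalType}.
Implicit Types f g : T -> R.

Lemma continuous_constant (a : R) : continuous (fun _ : T => a).
Proof. by move=> x; exact: cvg_cst. Qed.

Lemma continuous_add f g : continuous f -> continuous g ->
  continuous (fun x => f x + g x).
Proof. by move=> cf cg x; apply: cvgD; [exact: cf|exact: cg]. Qed.

Lemma continuous_sub f g : continuous f -> continuous g ->
  continuous (fun x => f x - g x).
Proof. by move=> cf cg x; apply: cvgB; [exact: cf|exact: cg]. Qed.

Lemma continuous_mul f g : continuous f -> continuous g ->
  continuous (fun x => f x * g x).
Proof. by move=> cf cg x; apply: cvgM; [exact: cf|exact: cg]. Qed.

Lemma continuous_scale (a : R) f : continuous f -> continuous (fun x => a * f x).
Proof. by move=> cf x; apply: cvgM; [exact: cvg_cst|exact: cf]. Qed.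

Lemma continuous_inv f : continuous f -> (forall x, f x != 0) ->
  continuous (fun x => (f x)^-1).
Proof. by move=> cf f0 x; apply: cvgV; [exact: f0|exact: cf]. Qed.
End RealValued.

Section Homotopy.
Context {R : realType}.
Implicit Types X Y Z : topologicalType.

Lemma continuous_paste Z Y (h : Z -> R) (f g : Z -> Y) :
  continuous h -> continuous f -> continuous g ->
  (forall z, h z = 0 -> f z = g z) ->
  continuous (fun z => if h z <= 0 then f z else g z).
Proof.
move=> ch cf cg fg z U /=.
case: (ltgtP (h z) 0) => [h0|h0|h0] /= Uz.
- have := cf z U Uz; have := ch z _ (lt_nbhsl h0); rewrite !nbhs_simpl /=.
  by apply: filterS2 => y hy; rewrite /= (ltW hy).
- have := cg z U Uz; have := ch z _ (lt_nbhsr h0); rewrite !nbhs_simpl /=.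
  by apply: filterS2 => y hy; rewrite /= leNgt hy.
- have := cf z U Uz; have := cg z U; rewrite -(fg z h0) => /(_ Uz).
  by rewrite !nbhs_simpl /=; apply: filterS2 => y gy fy /=; case: ifP.
Qed.

Definition clamp (s : R) : R := Num.max 0 (Num.min 1 s).

Lemma clamp_itv s : 0 <= clamp s <= 1.
Proof. by rewrite /clamp le_max lexx /= ge_max ler01 ge_min lexx. Qed.

Lemma clamp_id s : 0 <= s <= 1 -> clamp s = s.
Proof. by case/andP=> s0 s1; rewrite /clamp min_r // max_r. Qed.

Lemma clamp_continuous : continuous clamp.
Proof.
move=> s; apply: continuous_max; first exact: cvg_cst.
by apply: continuous_min; [exact: cvg_cst|exact: cvg_id].
Qed.

(** Composing with [clamp] in the time variable extends a homotopy from the unit interval to all of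
    [R], so that later constructions deal with continuity on the whole product. *)
Lemma homotopicP X Y (f g : X -> Y) : homotopic R f g <->
  exists H : R * X -> Y, [/\ continuous H, forall x, H (0, x) = f x &
                             forall x, H (1, x) = g x].
Proof.
split=> [] [H [cH H0 H1]]; last first.
  by exists H; split=> //; exact: continuous_subspaceT.
have c0 : clamp 0 = 0 by rewrite clamp_id // lexx ler01.
have c1 : clamp 1 = 1 by rewrite clamp_id // lexx ler01.
exists (fun z => H (clamp z.1, z.2)); split=> [|x|x] /=; rewrite ?c0 ?c1 //.
pose A : set (R * X) := (`[0, 1] `*` [set: X]).
have Acl z : (clamp z.1, z.2) \in A.
  by rewrite inE; split => //=; rewrite in_itv /=; exact: clamp_itv.
pose k (z : R * X) : A := exist _ (clamp z.1, z.2) (Acl z).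
have ck : continuous k.
  apply: continuous_comp_initial => z.
  apply: (@cvg_pair _ _ _ _ (nbhs (clamp z.1)) (nbhs z.2)).
    by apply: (continuous_comp (f := fst)); [exact: cvg_fst|exact: clamp_continuous].
  exact: cvg_snd.
move/subspace_sigL_continuousP: cH => cH.
have -> : (fun z => H (clamp z.1, z.2)) = sigL A H \o k by [].
by move=> z; apply: continuous_comp; [exact: ck|exact: cH].
Qed.

Lemma homotopic_sym X Y (f g : X -> Y) : homotopic R f g -> homotopic R g f.
Proof.
move=> /homotopicP[H [cH H0 H1]]; apply/homotopicP.
exists (fun z => H (1 - z.1, z.2)); split=> [|x|x] /=; rewrite ?subr0 ?subrr //.
move=> z; apply: continuous_comp; last exact: cH.
apply: (@cvg_pair _ _ _ _ (nbhs (1 - z.1)) (nbhs z.2)); last exact: cvg_snd.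
by apply: cvgB; [exact: cvg_cst|exact: cvg_fst].
Qed.

Lemma homotopic_trans X Y (f g h : X -> Y) :
  homotopic R f g -> homotopic R g h -> homotopic R f h.
Proof.
move=> /homotopicP[H [cH H0 H1]] /homotopicP[G [cG G0 G1]]; apply/homotopicP.
exists (fun z => if z.1 - 2^-1 <= 0 then H (2 * z.1, z.2)
                 else G (2 * z.1 - 1, z.2)); split=> [|x|x] /=.
- have cl : continuous (fun z : R * X => 2 * z.1).
    by move=> z; apply: cvgM; [exact: cvg_cst|exact: cvg_fst].
  apply: continuous_paste.
  + by move=> z; apply: cvgB; [exact: cvg_fst|exact: cvg_cst].
  + move=> z; apply: continuous_comp; last exact: cH.
    by apply: (@cvg_pair _ _ _ _ (nbhs (2 * z.1)) (nbhs z.2)); [exact: cl|exact: cvg_snd].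
  + move=> z; apply: continuous_comp; last exact: cG.
    apply: (@cvg_pair _ _ _ _ (nbhs (2 * z.1 - 1)) (nbhs z.2)); last exact: cvg_snd.
    by apply: cvgB; [exact: cl|exact: cvg_cst].
  + move=> z /subr0_eq ->; rewrite divff ?pnatr_eq0 // subrr.
    by rewrite H1 G0.
- by rewrite mulr0 sub0r oppr_le0 invr_ge0 ler0n.
- rewrite subr_le0 leNgt invf_lt1 ?ltr0n // ltr1n /= mulr1.
  by rewrite -[2 - 1]/(1 + 1 - 1) addrK.
Qed.

Lemma homotopic_compl X Y Z (k : Y -> Z) (f g : X -> Y) : continuous k ->
  homotopic R f g -> homotopic R (k \o f) (k \o g).
Proof.
move=> ck /homotopicP[H [cH H0 H1]]; apply/homotopicP.
exists (k \o H); split=> [z|x|x] /=; rewrite ?H0 ?H1 //.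
by apply: continuous_comp; [exact: cH|exact: ck].
Qed.

Lemma homotopic_compr X Y Z (k : X -> Y) (f g : Y -> Z) : continuous k ->
  homotopic R f g -> homotopic R (f \o k) (g \o k).
Proof.
move=> ck /homotopicP[H [cH H0 H1]]; apply/homotopicP.
exists (fun z => H (z.1, k z.2)); split=> [z|x|x] /=; rewrite ?H0 ?H1 //.
apply: continuous_comp; last exact: cH.
apply: (@cvg_pair _ _ _ _ (nbhs z.1) (nbhs (k z.2))); first exact: cvg_fst.
by apply: (continuous_comp (f := snd)); [exact: cvg_snd|exact: ck].
Qed.

Lemma homotopic_eq X Y (f g : X -> Y) : continuous f -> f =1 g -> homotopic R f g.
Proof.
move=> cf fg; apply/homotopicP; exists (f \o snd); split=> // z.
by apply: continuous_comp; [exact: cvg_snd|exact: cf].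
Qed.

Lemma homotopy_equivalent_refl X : homotopy_equivalent R X X.
Proof.
have cid : continuous (@idfun X) by move=> x; exact: cvg_id.
by exists idfun, idfun; split=> //; exact: homotopic_eq.
Qed.

Lemma homotopy_equivalent_sym X Y :
  homotopy_equivalent R X Y -> homotopy_equivalent R Y X.
Proof. by move=> [f [g [cf cg gf fg]]]; exists g, f; split. Qed.

Lemma homotopy_equivalent_trans X Y Z : homotopy_equivalent R X Y ->
  homotopy_equivalent R Y Z -> homotopy_equivalent R X Z.
Proof.
move=> [f [g [cf cg gf fg]]] [f' [g' [cf' cg' gf' fg']]].
exists (f' \o f), (g \o g'); split.
- by move=> x; apply: continuous_comp; [exact: cf|exact: cf'].
- by move=> x; apply: continuous_comp; [exact: cg'|exact: cg].
- apply: homotopic_trans gf.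
  exact: (homotopic_compl cg (homotopic_compr cf gf')).
- apply: homotopic_trans fg'.
  exact: (homotopic_compl cf' (homotopic_compr cg' fg)).
Qed.

Lemma contractible_equivalent X Y : homotopy_equivalent R X Y ->
  contractible R Y -> contractible R X.
Proof.
move=> [f [g [cf cg gf _]]] [y yP]; exists (g y).
apply: homotopic_trans (homotopic_sym gf) _.
exact: (homotopic_compl cg (homotopic_compr cf yP)).
Qed.
End Homotopy.

(** * Geometric realization *)

Lemma ptws_continuous (T Y : topologicalType) (I : Type) (f : T -> {ptws I -> Y}) :
  (forall i, continuous (fun z => f z i)) -> continuous f.
Proof.
move=> cf z; apply/cvg_sup => i U [V] [[W oW <-] Wz WU].
have Wf : nbhs z [set y | W (f y i)].
  by apply: (cf i z); exact: open_nbhs_nbhs.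
by apply: (@filterS _ (nbhs z) _ _ _ _ Wf) => y /WU.
Qed.

Section Polyhedra.
Context {R : realType}.

Lemma bigmin_continuous (T : topologicalType) (I : finType) (P : pred I)
    (a : R) (F : I -> T -> R) : (forall i, continuous (F i)) ->
  continuous (fun x => \big[Num.min/a]_(i | P i) F i x).
Proof.
move=> cF; apply: continuous_big => // -[x y].
apply: (@continuous_min _ _ (fun z : R * R => z.1) (fun z => z.2)).
  exact: cvg_fst.
exact: cvg_snd.
Qed.

Lemma sum_continuous (T : topologicalType) (I : finType) (P : pred I)
    (F : I -> T -> R) : (forall i, continuous (F i)) ->
  continuous (fun x => \sum_(i | P i) F i x).
Proof. by move=> cF; apply: continuous_big => //; exact: add_continuous. Qed.

Definition supp (V : finType) (x : V -> R) : {set V} :=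
  finset (fun v => x v != 0).

Definition bary_points (V : finType) (K : {set {set V}}) : set {ptws V -> R} :=
  [set x | [/\ forall v, 0 <= x v, \sum_v x v = 1 & supp x \in K]].

Definition polyhedron (V : finType) (K : {set {set V}}) : topologicalType :=
  set_type (bary_points K).

Section Coordinates.
Context {V : finType} {K : {set {set V}}}.
Implicit Type x : polyhedron K.

Definition bcoord x (v : V) : R := set_val x v.

Lemma bcoordP x : bary_points K (bcoord x).
Proof. exact: set_valP. Qed.

Lemma bcoord_ge0 x v : 0 <= bcoord x v.
Proof. by have [] := bcoordP x. Qed.

Lemma bcoord_sum x : \sum_v bcoord x v = 1.
Proof. by have [] := bcoordP x. Qed.

Lemma bcoord_supp x : supp (bcoord x) \in K.
Proof. by have [] := bcoordP x. Qed.

Lemma bcoord_le1 x v : bcoord x v <= 1.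
Proof.
by rewrite -(bcoord_sum x) (bigD1 v) //= lerDl sumr_ge0 // => u _; exact: bcoord_ge0.
Qed.

Lemma bcoord_inj x y : bcoord x =1 bcoord y -> x = y.
Proof. by move=> xy; apply: val_inj; apply/funext => v; exact: xy. Qed.

Lemma bcoord_continuous v : continuous (bcoord ^~ v).
Proof.
move=> x; apply: (@continuous_comp _ _ _
  (set_val : polyhedron K -> {ptws V -> R}) (fun f => f v)).
  exact: initial_continuous.
exact: (@proj_continuous _ (fun=> R : topologicalType)).
Qed.

Lemma polyhedron_continuous (T : topologicalType) (f : T -> polyhedron K) :
  (forall v, continuous (fun z => bcoord (f z) v)) -> continuous f.
Proof.
by move=> cf; apply: continuous_comp_initial; apply: ptws_continuous.
Qed.

Definition to_polyhedron T (F : T -> V -> R) (FP : forall z, bary_points K (F z))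
  (z : T) : polyhedron K := exist _ (F z : {ptws V -> R}) (mem_set (FP z)).

Lemma bcoord_to_polyhedron T (F : T -> V -> R) FP z v :
  bcoord (@to_polyhedron T F FP z) v = F z v.
Proof. by []. Qed.

Lemma to_polyhedron_continuous (T : topologicalType) (F : T -> V -> R) FP :
  (forall v, continuous (fun z => F z v)) -> continuous (@to_polyhedron T F FP).
Proof. by move=> cF; exact: polyhedron_continuous. Qed.
End Coordinates.

(** A face containing both supports contains the segment between the two points, so the
    straight-line homotopy stays in the polyhedron. *)
Lemma homotopic_linear (T : topologicalType) V (K : {set {set V}})
    (f g : T -> polyhedron K) : is_complex K -> continuous f -> continuous g ->
  (forall z, supp (bcoord (f z)) :|: supp (bcoord (g z)) \in K) -> homotopic R f g.
Proof.
move=> [_ Kdown] cf cg fgK; apply/homotopicP.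
pose F (z : R * T) v := (1 - clamp z.1) * bcoord (f z.2) v + clamp z.1 * bcoord (g z.2) v.
have FP z : bary_points K (F z).
  have /andP[s0 s1] := clamp_itv z.1.
  split=> [v||].
  - by rewrite addr_ge0 // mulr_ge0 ?subr_ge0 ?bcoord_ge0.
  - by rewrite big_split /= -!mulr_sumr !bcoord_sum !mulr1 subrK.
  apply: Kdown (fgK z.2); apply/fintype.subsetP => v; rewrite !inE.
  apply: contraNT; rewrite negb_or !negbK /F => /andP[/eqP -> /eqP ->].
  by rewrite !mulr0 addr0.
exists (to_polyhedron FP); split=> [|x|x].
- apply: to_polyhedron_continuous => v.
  have c1 : continuous (fun z : R * T => clamp z.1).
    exact: continuous_compose (@fst_continuous _ _) clamp_continuous.
  have c2 (h : T -> polyhedron K) : continuous h ->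
      continuous (fun z : R * T => bcoord (h z.2) v).
    move=> ch; exact: (continuous_compose
      (continuous_compose (@snd_continuous _ _) ch) (@bcoord_continuous _ _ v)).
  apply: continuous_add; apply: continuous_mul; try exact: c2; last exact: c1.
  by apply: continuous_sub; [exact: continuous_constant|exact: c1].
- apply: bcoord_inj => v; rewrite bcoord_to_polyhedron /F /= clamp_id ?lexx ?ler01 //.
  by rewrite subr0 mul1r mul0r addr0.
- apply: bcoord_inj => v; rewrite bcoord_to_polyhedron /F /= clamp_id ?lexx ?ler01 //.
  by rewrite subrr mul1r mul0r add0r.
Qed.

(** The retraction [r] subtracts the least coordinate over [tau] from every vertex of [tau] and
    gives the total to the apex [p]. Some vertex of [tau] then drops out of the support, and a point
    that moves does so inside the face spanned by [p] and its old support. *)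
Lemma polyhedron_collapse V (K : {set {set V}}) (tau : {set V}) (p : V) :
  is_complex K -> tau != finset.set0 -> p \notin tau -> coned K tau p ->
  homotopy_equivalent R (polyhedron K) (polyhedron (collapse K tau)).
Proof.
move=> cK tau0 ptau Kcone; have [K0 Kdown] := cK.
have cC := collapse_complex cK tau0.
pose m (x : V -> R) := \big[Num.min/1]_(u in tau) x u.
have [u0 u0tau] := set0Pn _ tau0.
pose r (x : V -> R) v := x v - (v \in tau)%:R * m x + (v == p)%:R * (#|tau|%:R * m x).
have mle x u : u \in tau -> m x <= x u by move=> ut; exact: bigmin_le_cond.
have mP (x : polyhedron K) : 0 <= m (bcoord x) /\
    exists2 u, u \in tau & m (bcoord x) = bcoord x u.
  have [u ut mE] := @eq_bigmin _ _ _ 1 u0 (mem tau) (bcoord x) u0tau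
    (fun u _ => bcoord_le1 x u).
  have {}mE : m (bcoord x) = bcoord x u by exact: mE.
  by split; [rewrite mE bcoord_ge0|exists u].
have m0 (x : polyhedron K) : ~~ (tau \subset supp (bcoord x)) -> m (bcoord x) = 0.
  case/fintype.subsetPn => u ut; rewrite inE negbK => /eqP xu.
  by apply/eqP; rewrite eq_le (mP x).1 andbT -xu mle.
have rid (x : polyhedron K) : m (bcoord x) = 0 -> r (bcoord x) =1 bcoord x.
  by move=> mx v; rewrite /r mx !mulr0 subr0 addr0.
have rsupp (x : polyhedron K) : supp (r (bcoord x)) \subset p |: supp (bcoord x).
  apply/fintype.subsetP => v; rewrite !inE => rv; case: (eqVneq v p) => //= vp; move: rv.
  rewrite /r (negPf vp) mul0r addr0; apply: contraNneq => xv.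
  have [vt|_] := boolP (v \in tau); last by rewrite mul0r xv subr0.
  suff -> : m (bcoord x) = 0 by rewrite mulr0 xv subr0.
  by apply/eqP; rewrite eq_le (mP x).1 andbT -xv mle.
have psupp (x : polyhedron K) : tau \subset supp (bcoord x) ->
    p |: supp (bcoord x) \in K.
  by apply: Kcone; exact: bcoord_supp.
have rP (x : polyhedron K) : bary_points (collapse K tau) (r (bcoord x)).
  split=> [v||].
  - have [mx _] := mP x; rewrite /r addr_ge0 ?mulr_ge0 ?ler0n // subr_ge0.
    have [vt|_] := boolP (v \in tau); last by rewrite mul0r bcoord_ge0.
    by rewrite mul1r mle.
  - rewrite /r big_split /= sumrB bcoord_sum -!mulr_suml.
    have -> : \sum_(v : V) (v == p)%:R = 1 :> R.
      by rewrite (bigD1 p) //= eqxx big1 ?addr0 // => v /negPf ->.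
    have -> : \sum_(v : V) (v \in tau)%:R = #|tau|%:R :> R.
      rewrite -sum1_card natr_sum [RHS]big_mkcond /=.
      by apply: eq_bigr => v _; case: (v \in tau).
    by rewrite mul1r subrK.
  - rewrite inE; have [u ut mu] := (mP x).2; apply/andP; split; last first.
      apply/fintype.subsetPn; exists u => //; rewrite inE negbK /r ut mu mul1r subrr add0r.
      by rewrite (negPf (memPn ptau u ut)) mul0r.
    have [tx|/m0 mx] := boolP (tau \subset supp (bcoord x)).
      exact: Kdown (rsupp x) (psupp x tx).
    have -> : supp (r (bcoord x)) = supp (bcoord x).
      by apply/finset.setP => v; rewrite !inE rid.
    exact: bcoord_supp.
have iP (x : polyhedron (collapse K tau)) : bary_points K (bcoord x).
  have [? ? h] := bcoordP x; split=> //; by move: h; rewrite inE => /andP[].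
have cr : continuous (to_polyhedron rP).
  apply: to_polyhedron_continuous => v.
  have cm : continuous (fun x : polyhedron K => m (bcoord x)).
    by apply: bigmin_continuous => u; exact: bcoord_continuous.
  apply: continuous_add; last by do 2!apply: continuous_scale.
  by apply: continuous_sub; [exact: bcoord_continuous|exact: continuous_scale].
have ci : continuous (to_polyhedron iP).
  by apply: to_polyhedron_continuous => v; exact: bcoord_continuous.
exists (to_polyhedron rP), (to_polyhedron iP); split=> //.
- apply: homotopic_sym; apply: homotopic_linear => //.
  + by move=> x; exact: cvg_id.
  + by move=> x; apply: continuous_comp; [exact: cr|exact: ci].
  move=> x; have [tx|/m0 mx] := boolP (tau \subset supp (bcoord x)).
    apply: Kdown (psupp x tx); rewrite finset.subUset; apply/andP; split.
      exact: finset.subsetUr.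
    exact: rsupp.
  have -> : supp (bcoord ((to_polyhedron iP \o to_polyhedron rP) x)) = supp (bcoord x).
    by apply/finset.setP => v; rewrite !inE -[bcoord _ v]/(r (bcoord x) v) rid.
  by rewrite finset.setUid bcoord_supp.
- apply: homotopic_eq.
    by move=> x; apply: continuous_comp; [exact: ci|exact: cr].
  move=> x; apply: bcoord_inj => v /=.
  rewrite -[LHS]/(r (bcoord (to_polyhedron iP x)) v) rid //.
  by apply: m0; have := bcoord_supp x; rewrite inE => /andP[].
Qed.

Lemma polyhedron_relabel V W (f : V -> W) (K : {set {set V}}) :
  is_complex K -> injective f ->
  homotopy_equivalent R (polyhedron K) (polyhedron (relabel f K)).
Proof.
move=> cK finj.
pose push (x : polyhedron K) w := \sum_(v | f v == w) bcoord x v.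
pose pull (y : polyhedron (relabel f K)) v := bcoord y (f v).
have pushE x v : push x (f v) = bcoord x v.
  rewrite /push (big_pred1 v) // => u /=; exact: inj_eq.
have pushN x w : w \notin codom f -> push x w = 0.
  move=> wf; rewrite /push big_pred0 // => v; apply: contraNF wf => /eqP <-.
  exact: codom_f.
have pushP x : bary_points (relabel f K) (push x).
  split=> [w||].
  - by apply: sumr_ge0 => v _; exact: bcoord_ge0.
  - rewrite /push -(bcoord_sum x) (partition_big f predT) //=.
  - have -> : supp (push x) = [set f v | v in supp (bcoord x)]%SET.
      apply/finset.setP => w; rewrite inE; apply/idP/imsetP => [pw|[v]]; last first.
        by rewrite inE => xv ->; rewrite pushE.
      have [/codomP[v wE]|/pushN p0] := boolP (w \in codom f); last by rewrite p0 eqxx in pw.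
      by exists v => //; rewrite inE -pushE -wE.
    by apply: imset_f; exact: bcoord_supp.
have yN (y : polyhedron (relabel f K)) w : w \notin codom f -> bcoord y w = 0.
  move=> wf; apply/eqP; apply: contraNT wf => yw.
  have /imsetP[A AK sE] := bcoord_supp y.
  have : w \in supp (bcoord y) by rewrite inE.
  by rewrite sE => /imsetP[v _ ->]; exact: codom_f.
have pullP y : bary_points K (pull y).
  split=> [v||].
  - exact: bcoord_ge0.
  - rewrite -(bcoord_sum y) (bigID (mem (codom f))) /= [X in _ + X]big1 ?addr0; last first.
      by move=> w; exact: yN.
    rewrite (reindex_omap f (fun w => [pick v | f v == w])) /=.
      apply: eq_bigl => v; rewrite codom_f.
      by case: pickP => [u /eqP /finj ->|/(_ v)]; rewrite eqxx.
    by move=> w /codomP[v ->]; case: pickP => [u /eqP e|/(_ v)]; rewrite /= ?e ?eqxx.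
  - have /imsetP[A AK sE] := bcoord_supp y.
    suff -> : supp (pull y) = A by [].
    apply/finset.setP => v; rewrite inE -[LHS]/(bcoord y (f v) != 0).
    have <- : (f v \in supp (bcoord y)) = (bcoord y (f v) != 0) by rewrite inE.
    by rewrite sE mem_imset.
have cpush : continuous (to_polyhedron pushP).
  apply: to_polyhedron_continuous => w; apply: sum_continuous => v.
  exact: bcoord_continuous.
have cpull : continuous (to_polyhedron pullP).
  by apply: to_polyhedron_continuous => v; exact: bcoord_continuous.
exists (to_polyhedron pushP), (to_polyhedron pullP); split=> //; apply: homotopic_eq.
- by move=> x; apply: continuous_comp; [exact: cpush|exact: cpull].
- by move=> x; apply: bcoord_inj => v /=; exact: pushE.
- by move=> x; apply: continuous_comp; [exact: cpull|exact: cpush].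
- move=> y; apply: bcoord_inj => w /=; rewrite -[LHS]/(push _ w).
  have [/codomP[v ->]|wf] := boolP (w \in codom f); first by rewrite pushE.
  by rewrite pushN // yN.
Qed.

Lemma peq_homotopy_equivalent V W (K : {set {set V}}) w (L : {set {set W}}) x :
  peq K w L x -> homotopy_equivalent R (polyhedron K) (polyhedron L).
Proof.
elim=> {V W K w L x}.
- by move=> V K w _; exact: homotopy_equivalent_refl.
- by move=> V W K w L x _; exact: homotopy_equivalent_sym.
- by move=> U V W J u K v L w _ + _; exact: homotopy_equivalent_trans.
- by move=> V K tau p w cK tau0 _; exact: polyhedron_collapse.
- by move=> V K w x _ _; exact: homotopy_equivalent_refl.
- by move=> V W f K w; exact: polyhedron_relabel.
Qed.
End Polyhedra.
Arguments polyhedron R {V} K.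

(** * Normal forms are wedges of spheres *)

Section Push.
Context {R : realType} {V : finType}.
Implicit Types (y : V -> R) (A : {set V}) (F : {set {set V}}) (s : R).

(** For [y] in the simplex [A] this is the share of [y] that is spread evenly over [A]: it is 1 at
    the barycenter and vanishes exactly on the boundary. *)
Definition depth A y : R := #|A|%:R * \big[Num.min/1]_(u in A) y u.

(* For [c = 1 + s], the parabola [c * (2 - c * (1 - Z))] lies below [1 / (1 - Z)]
   and touches it at [Z = 1 - 1 / c], where the two regimes of [push_scale] and
   [push_shift] meet. *)
Definition push_scale F s y : R :=
  let Z := \sum_(A in F) depth A y in
  Num.min ((1 + s) * (2 - (1 + s) * (1 - Z))) (1 + s).

Definition push_shift F s y A : R := Num.min (push_scale F s y * depth A y) s.

(* For [s] from 0 to 1, the star of [x] is contracted to [x] while every simplex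
   [A] of [F] is inflated so as to cover all of the boundary of [x |: A]. *)
Definition push x F s y (u : V) : R :=
  push_scale F s y * y u
  + (u == x)%:R * (1 - push_scale F s y + \sum_(A in F) push_shift F s y A)
  - \sum_(A in F) (u \in A)%:R * (push_shift F s y A / #|A|%:R).

Lemma depth_eq0 A y : A != finset.set0 -> (forall v, 0 <= y v <= 1) ->
  ~~ (A \subset supp y) -> depth A y = 0.
Proof.
move=> A0 y01 /fintype.subsetPn[u uA]; rewrite inE negbK => /eqP yu.
suff : \big[Num.min/1]_(u in A) y u = 0 by rewrite /depth => ->; rewrite mulr0.
apply/eqP; rewrite eq_le; apply/andP; split.
  by rewrite -yu; exact: bigmin_le_cond.
by apply/bigmin_geP; split=> // v _; case/andP: (y01 v).
Qed.

Lemma push_scale_far F s y : (forall A, A \in F -> depth A y = 0) -> 0 <= s ->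
  push_scale F s y = 1 - s ^+ 2.
Proof.
move=> y0 s0; rewrite /push_scale big1 // subr0 mulr1 min_l; [ring|nra].
Qed.

(** Away from the open facets the parabola takes the value [(1 + s) * (1 - s)], so the map is the
    straight-line contraction to [x] with parameter [s ^+ 2]. *)
Lemma push_far x F s y u : (forall A, A \in F -> depth A y = 0) -> 0 <= s ->
  push x F s y u = (1 - s ^+ 2) * y u + (u == x)%:R * s ^+ 2.
Proof.
move=> y0 s0; rewrite /push push_scale_far //.
have B0 A : A \in F -> push_shift F s y A = 0.
  by move=> AF; rewrite /push_shift y0 // mulr0 min_l.
rewrite !big1 ?addr0 ?subr0 //; last by move=> A /B0 ->; rewrite mul0r mulr0.
by ring.
Qed.

(** A point of a complex in normal form is interior to at most one further facet, so the study of
    [push] reduces to a single simplex. *)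
Lemma push_near x F A s y u : A \in F ->
  (forall B, B \in F -> B != A -> depth B y = 0) -> 0 <= s ->
  push x F s y u = push x [set A]%SET s y u.
Proof.
move=> AF y0 s0.
have aE : push_scale F s y = push_scale [set A]%SET s y.
  rewrite /push_scale big_set1 (bigD1 A) //= big1 ?addr0 // => B /andP[].
  exact: y0.
have BE B : push_shift F s y B = push_shift [set A]%SET s y B.
  by rewrite /push_shift aE.
have B0 B : B \in F -> B != A -> push_shift F s y B = 0.
  by move=> BF BA; rewrite /push_shift y0 // mulr0 min_l.
rewrite /push aE !big_set1 !(bigD1 A AF) /= !BE.
rewrite big1 ?addr0; last by move=> B /andP[]; exact: B0.
by rewrite big1 ?addr0 // => B /andP[BF BA]; rewrite B0 // mul0r mulr0.
Qed.

Lemma push_continuous (T : topologicalType) (f : T -> V -> R) (g : T -> R) x F u :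
  (forall v, continuous (fun z => f z v)) -> continuous g ->
  continuous (fun z => push x F (g z) (f z) u).
Proof.
move=> cf cg.
have cdepth A : continuous (fun z => depth A (f z)).
  by apply: continuous_scale; exact: bigmin_continuous.
have c1 : continuous (fun z => 1 + g z).
  by apply: continuous_add => //; exact: continuous_constant.
have cmin (p q : T -> R) : continuous p -> continuous q ->
    continuous (fun z => Num.min (p z) (q z)).
  by move=> cp cq z; apply: (continuous_min (cp z) (cq z)).
have ca : continuous (fun z => push_scale F (g z) (f z)).
  apply: (cmin) => //; apply: continuous_mul => //.
  apply: continuous_sub; first exact: continuous_constant.
  apply: continuous_mul => //; apply: continuous_sub; first exact: continuous_constant.
  exact: sum_continuous.
have cB A : continuous (fun z => push_shift F (g z) (f z) A).
  by apply: (cmin) => //; exact: continuous_mul.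
apply: continuous_sub; first apply: continuous_add.
- exact: continuous_mul.
- apply: continuous_scale; apply: continuous_add; last exact: sum_continuous.
  by apply: continuous_sub => //; exact: continuous_constant.
apply: sum_continuous => A; apply: continuous_scale.
by apply: continuous_mul => //; exact: continuous_constant.
Qed.

Section OneSimplex.
Variables (x : V) (A : {set V}) (y : V -> R) (s : R).
Hypotheses (xA : x \notin A) (A0 : A != finset.set0).
Hypotheses (y_ge0 : forall v, 0 <= y v) (y_sum : \sum_v y v = 1).
Hypotheses (y_supp : supp y = A) (s01 : 0 <= s <= 1).

Let a := push_scale [set A]%SET s y.
Let b := push_shift [set A]%SET s y A.
Let z := depth A y.

Lemma simplex_min : exists2 u, u \in A & z = #|A|%:R * y u /\
  forall v, v \in A -> y u <= y v.
Proof.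
have [u0 u0A] := set0Pn _ A0.
have y_le1 v : y v <= 1.
  by rewrite -y_sum (bigD1 v) //= lerDl sumr_ge0.
have [u uA uE] := @eq_bigmin _ _ _ 1 u0 (mem A) y u0A (fun u _ => y_le1 u).
exists u => //; split=> [|v vA]; first by rewrite /z /depth; congr (_ * _).
suff <- : \big[Num.min/1]_(u in A) y u = y u by exact: bigmin_le_cond.
exact: uE.
Qed.

Lemma depth_itv : 0 <= z <= 1.
Proof.
have [u uA [zE ymin]] := simplex_min.
have -> : z = \sum_(v in A) y u by rewrite zE sumr_const mulr_natl.
rewrite sumr_ge0 //= -y_sum [X in _ <= X](bigID (mem A)) /=.
rewrite -[X in X <= _]addr0 lerD ?sumr_ge0 //.
exact: ler_sum.
Qed.

Lemma push_scale_ge0 : 0 <= a.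
Proof.
have /andP[s0 s1] := s01; have /andP[z0 z1] := depth_itv.
rewrite /a /push_scale big_set1 -/z le_min; apply/andP; split; last lra.
by apply: mulr_ge0; [lra|nra].
Qed.

(** The inequalities make the coordinates in [A] and at [x] nonnegative. The alternative makes one
    of them vanish, the least one in [A] or the one at [x], which puts the image on the boundary of
    [x |: A]. *)
Lemma push_shiftP : [/\ 0 <= b, b <= a * z, 0 <= 1 - a + b &
  b = a * z \/ 1 - a + b = 0].
Proof.
have /andP[s0 s1] := s01; have /andP[z0 z1] := depth_itv.
have a0 := push_scale_ge0.
have az0 : 0 <= a * z by exact: mulr_ge0.
have ac : a <= 1 + s by rewrite /a /push_scale ge_min lexx orbT.
have ac' : a <= (1 + s) * (2 - (1 + s) * (1 - z)).
  by rewrite /a /push_scale big_set1 ge_min lexx.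
have aE : a = (1 + s) * (2 - (1 + s) * (1 - z)) \/ a = 1 + s.
  by rewrite /a /push_scale big_set1 -/z /Num.min; case: ifP; [left|right].
have bE : b = Num.min (a * z) s by [].
split; rewrite ?bE ?ge_min ?lexx ?le_min ?az0 ?s0 //.
- have [h|h] := lerP (a * z) s; last lra.
  (* With [w = (1 + s) * (1 - z)] the right-hand side is [w * (2 - w)], which is at most 1. *)
  have : a * (1 - z) <= (1 + s) * (2 - (1 + s) * (1 - z)) * (1 - z).
    by apply: ler_wpM2r => //; lra.
  have := sqr_ge0 ((1 + s) * (1 - z) - 1).
  by rewrite expr2; nra.
have [h|h] := lerP (a * z) s; [by left|right].
have [aE'|->] := aE; last ring.
(* Here [a] is the parabola and at most [c = 1 + s]. But [c * z > s] gives [w < 1], and then the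
   parabola [c * (2 - w)] would exceed [c]. *)
have : (1 + s) * z > s by apply: lt_le_trans h _; exact: ler_wpM2r.
move: ac; rewrite aE'; set c := 1 + s => cc cz.
have c0 : 0 < c by rewrite /c; lra.
have e0 : 0 < 1 - c * (1 - z) by move: cz; rewrite /c; lra.
have := mulr_gt0 c0 e0; move: cc; set w := c * (1 - z); nra.
Qed.

Lemma push1E u : push x [set A]%SET s y u =
  a * y u + (u == x)%:R * (1 - a + b) - (u \in A)%:R * (b / #|A|%:R).
Proof. by rewrite /push !big_set1. Qed.

Lemma card_neq0 : #|A|%:R != 0 :> R.
Proof. by rewrite pnatr_eq0 cards_eq0. Qed.

Lemma push_ge0 u : 0 <= push x [set A]%SET s y u.
Proof.
have [b0 baz ab _] := push_shiftP; have a0 := push_scale_ge0.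
rewrite push1E; have [uA|uA] := boolP (u \in A); last first.
  by rewrite mul0r subr0 addr_ge0 // mulr_ge0.
rewrite (negPf (memPn xA u uA)) mul0r addr0 mul1r subr_ge0.
have [v vA [zE ymin]] := simplex_min.
have cA : 0 < #|A|%:R :> R by rewrite lt_neqAle eq_sym card_neq0 ler0n.
rewrite ler_pdivrMr //; apply: le_trans baz _.
rewrite zE mulrCA [X in _ <= X]mulrC ler_wpM2l ?ler0n //.
by rewrite ler_wpM2l // ymin.
Qed.

Lemma push_sum : \sum_u push x [set A]%SET s y u = 1.
Proof.
under eq_bigr do rewrite push1E.
rewrite sumrB big_split /= -mulr_sumr y_sum -!mulr_suml.
have -> : \sum_u (u == x)%:R = 1 :> R.
  by rewrite (bigD1 x) //= eqxx big1 ?addr0 // => v /negPf ->.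
have -> : \sum_u (u \in A)%:R = #|A|%:R :> R.
  rewrite -sum1_card natr_sum [RHS]big_mkcond /=.
  by apply: eq_bigr => v _; case: (v \in A).
by rewrite [#|A|%:R * _]mulrC divfK ?card_neq0 //; ring.
Qed.

Lemma push_supp : supp (push x [set A]%SET s y) \proper x |: A.
Proof.
rewrite finset.properEneq; apply/andP; split; last first.
  apply/fintype.subsetP => u; rewrite !inE; apply: contraNT; rewrite negb_or.
  case/andP => /negPf ux uA; rewrite push1E ux (negPf uA) !mul0r addr0 subr0.
  suff -> : y u = 0 by rewrite mulr0.
  by apply/eqP; apply: contraNT uA => yu; rewrite -y_supp inE.
have [_ _ _ [bE|ab]] := push_shiftP.
  have [v vA [zE _]] := simplex_min.
  apply/eqP => /finset.setP/(_ v); rewrite !inE vA orbT push1E vA mul1r.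
  rewrite (negPf (memPn xA v vA)) mul0r addr0 bE zE mulrCA.
  rewrite [#|A|%:R * _]mulrC mulfK ?card_neq0 //.
  by rewrite subrr eqxx.
apply/eqP => /finset.setP/(_ x); rewrite !inE eqxx /= push1E eqxx ab mulr0 addr0.
rewrite (negPf xA) mul0r subr0.
suff -> : y x = 0 by rewrite mulr0 eqxx.
by apply/eqP; apply: contraNT xA => yu; rewrite -y_supp inE.
Qed.
End OneSimplex.
End Push.

Lemma matrix_continuous (T Y : topologicalType) m n (f : T -> 'M[Y]_(m, n)) :
  (forall i j, continuous (fun z => f z i j)) -> continuous f.
Proof.
move=> cf z U [P Pf PU].
have : \forall y \near z, forall ij : 'I_m * 'I_n, P ij.1 ij.2 (f y ij.1 ij.2).
  by apply: filter_forall => -[i j]; exact: (cf i j z _ (Pf i j)).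
by apply: filterS => y Py; apply: PU => i j; exact: (Py (i, j)).
Qed.

(** * The boundary of a simplex as a round sphere *)

Definition boundary (V : finType) (x : V) (A : {set V}) : {set {set V}} :=
  [set S : {set V} | S \proper x |: A]%SET.

Section SphereChart.
Context {R : realType} {V : finType}.
Variables (x : V) (A : {set V}) (d : nat).
Hypotheses (xA : x \notin A) (cardA : #|A| = d.+1).
Local Notation P := (polyhedron R (boundary x A)).
Local Notation S := (sphere R d).

Let e (i : 'I_d.+1) : V := enum_val (cast_ord (esym cardA) i).
Let u0 : V := e ord0.
(* The vertices of the simplex [x |: A] are sent to the basis vectors, except
   [u0] that is sent to minus their sum. *)
Let c (i : 'I_d.+1) : V := if i == ord0 then x else e i.

Let eA i : e i \in A. Proof. exact: enum_valP. Qed.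

Let e_inj : injective e.
Proof. by move=> i j /enum_val_inj /cast_ord_inj. Qed.

Let c_inj : injective c.
Proof.
move=> i j; rewrite /c; case: eqVneq => [->|i0]; case: eqVneq => [->|j0] //.
- by move=> xe; move: xA; rewrite xe eA.
- by move=> xe; move: xA; rewrite -xe eA.
- exact: e_inj.
Qed.

Let c_neq i : c i != u0.
Proof.
rewrite /c; case: (eqVneq i ord0) => [_|i0]; last by rewrite (inj_eq e_inj).
by rewrite eq_sym (memPn xA) ?eA.
Qed.

Let cP (v : V) : v \in x |: A -> v = u0 \/ exists i, v = c i.
Proof.
rewrite !inE => /predU1P[->|vA]; first by right; exists ord0; rewrite /c eqxx.
pose i := cast_ord cardA (enum_rank_in vA v).
have vE : v = e i by rewrite /e cast_ordK enum_rankK_in.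
have [i0|i0] := eqVneq i ord0; first by left; rewrite vE i0.
by right; exists i; rewrite /c (negPf i0).
Qed.

Let cA i : c i \in x |: A.
Proof. by rewrite /c !inE; case: ifP => _; rewrite ?eqxx // eA orbT. Qed.

Let u0A : u0 \in x |: A. Proof. by rewrite !inE eA orbT. Qed.

Let sum_simplex (g : V -> R) : (forall v, v \notin x |: A -> g v = 0) ->
  \sum_v g v = g u0 + \sum_i g (c i).
Proof.
move=> g0; rewrite (bigD1 u0) //=; congr (_ + _).
rewrite (bigID (mem (codom c))) /= [X in _ + X]big1 ?addr0; last first.
  move=> v /andP[vu vc]; apply: g0; apply/negP => /cP[/eqP|[i vE]].
    by rewrite (negPf vu).
  by rewrite vE codom_f in vc.
rewrite (reindex_omap c (fun w => [pick v | c v == w])) /=.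
  apply: eq_bigl => v; rewrite codom_f c_neq.
  by case: pickP => [u /eqP /c_inj ->|/(_ v)]; rewrite eqxx.
move=> w /andP[_ /codomP[v ->]].
by case: pickP => [u /eqP h|/(_ v)]; rewrite /= ?h ?eqxx.
Qed.

Let bcoord0 (q : P) (v : V) : v \notin x |: A -> bcoord q v = 0.
Proof.
move=> vA; apply/eqP; apply: contraNT vA => qv.
have := bcoord_supp q; rewrite inE => /proper_sub /fintype.subsetP; apply.
by rewrite inE.
Qed.

Let min0 (q : P) : exists2 v, v \in x |: A & bcoord q v = 0.
Proof.
have := bcoord_supp q; rewrite inE => /properP[_ [v vA]].
by rewrite inE negbK => /eqP; exists v.
Qed.

(** The linear map determined by the images of the vertices; dividing by [len] projects radially to
    the sphere. *)
Let dir (q : P) (j : 'I_d.+1) : R := bcoord q (c j) - bcoord q u0.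
Let len (q : P) : R := Num.sqrt (\sum_j dir q j ^+ 2).

Let len_gt0 q : 0 < len q.
Proof.
rewrite sqrtr_gt0 lt_neqAle eq_sym sumr_ge0 ?andbT; last by move=> j _; exact: sqr_ge0.
apply/negP => /eqP /psumr_eq0P h.
have {}h j : bcoord q (c j) = bcoord q u0.
  have /eqP := h (fun j _ => sqr_ge0 _) j isT.
  by rewrite sqrf_eq0 subr_eq0 => /eqP.
have [v vA qv] := min0 q.
have q0 : bcoord q u0 = 0.
  by have [vE|[j vE]] := cP vA; rewrite -?vE // -(h j) -vE.
have := bcoord_sum q; rewrite sum_simplex; last by move=> w; exact: bcoord0.
rewrite q0 add0r big1 => [|j _]; last by rewrite h q0.
by move/eqP; rewrite eq_sym oner_eq0.
Qed.

Let to_sphereP (q : P) : (\row_j (dir q j / len q)) \in S.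
Proof.
rewrite inE /sphere /=; under eq_bigr do rewrite mxE expr_div_n.
rewrite -mulr_suml sqr_sqrtr; last by apply: sumr_ge0 => j _; exact: sqr_ge0.
rewrite divff //; have := len_gt0 q; rewrite sqrtr_gt0; exact: lt0r_neq0.
Qed.

Definition to_sphere (q : P) : S :=
  exist _ (\row_j (dir q j / len q)) (to_sphereP q).

(** The inverse chart. Every vector is a unique combination of the [d.+2] vertex images with
    nonnegative weights that are not all positive: [- bot p] is the weight of [u0], the others are
    [p ord0 j - bot p], and [mass p] is their sum. *)
Let bot (p : 'rV[R]_d.+1) : R := \big[Num.min/0]_j p ord0 j.
Let mass (p : 'rV[R]_d.+1) : R := \sum_j (p ord0 j - bot p) - bot p.
Let weight (p : 'rV[R]_d.+1) (v : V) : R :=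
  \sum_(j | c j == v) (p ord0 j - bot p) - (v == u0)%:R * bot p.

Let bot_le p j : bot p <= p ord0 j. Proof. exact: bigmin_le. Qed.

Let bot_le0 p : bot p <= 0. Proof. exact: bigmin_le_id. Qed.

Let botP p : bot p = 0 \/ exists j, bot p = p ord0 j.
Proof.
rewrite /bot; elim/big_ind: _ => [|a b Ha Hb|j _]; [by left| |by right; exists j].
by rewrite /Num.min; case: ifP.
Qed.

Let weight_c p j : weight p (c j) = p ord0 j - bot p.
Proof.
rewrite /weight (negPf (c_neq j)) mul0r subr0 (big_pred1 j) // => i /=.
exact: inj_eq.
Qed.

Let weight_u0 p : weight p u0 = - bot p.
Proof.
rewrite /weight eqxx mul1r big_pred0 ?add0r // => j.
exact: negPf (c_neq j).
Qed.

Let weight0 p (v : V) : v \notin x |: A -> weight p v = 0.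
Proof.
move=> vA; rewrite /weight big_pred0 => [|j]; last first.
  by apply: contraNF vA => /eqP <-; exact: cA.
have -> : v == u0 = false by apply: contraNF vA => /eqP ->; exact: u0A.
by rewrite mul0r subr0.
Qed.

Let weight_ge0 p v : 0 <= weight p v.
Proof.
apply: addr_ge0; first by apply: sumr_ge0 => j _; rewrite subr_ge0.
by rewrite oppr_ge0 mulr_ge0_le0.
Qed.

Let weight_sum p : \sum_v weight p v = mass p.
Proof.
rewrite sum_simplex ?weight_u0 /mass 1?addrC; last by move=> v; exact: weight0.
by congr (_ - _); apply: eq_bigr => j _; rewrite weight_c.
Qed.

Let mass_gt0 (p : S) : 0 < mass (set_val p).
Proof.
rewrite -weight_sum lt_neqAle eq_sym sumr_ge0 ?andbT //.
apply/negP => /eqP /psumr_eq0P h.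
have {}h v : weight (set_val p) v = 0 by apply: h => // w _; exact: weight_ge0.
have b0 : bot (set_val p) = 0.
  by apply/eqP; rewrite -oppr_eq0 -weight_u0 h.
have := set_valP p; rewrite /sphere /= big1 => [/eqP|j _].
  by rewrite eq_sym oner_eq0.
by have := h (c j); rewrite weight_c b0 subr0 => ->; rewrite expr0n.
Qed.

Let of_sphereP (p : S) :
  bary_points (boundary x A) (fun v => weight (set_val p) v / mass (set_val p)).
Proof.
have m0 := mass_gt0 p; split=> [v||].
- by rewrite divr_ge0 ?weight_ge0 // ltW.
- by rewrite -mulr_suml weight_sum divff // lt0r_neq0.
rewrite inE; apply/properP; split.
  apply/fintype.subsetP => v; rewrite inE; apply: contraNT => /weight0 ->.
  by rewrite mul0r.
have [b0|[j bj]] := botP (set_val p).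
  by exists u0 => //; rewrite inE negbK weight_u0 b0 oppr0 mul0r.
by exists (c j) => //; rewrite inE negbK weight_c bj subrr mul0r.
Qed.

Definition of_sphere : S -> P := to_polyhedron of_sphereP.

Lemma of_sphereK : cancel of_sphere to_sphere.
Proof.
move=> p; have m0 := mass_gt0 p; apply: val_inj; apply/rowP => j /=.
have dE i : dir (of_sphere p) i = set_val p ord0 i / mass (set_val p).
  rewrite /dir !bcoord_to_polyhedron weight_c weight_u0 -mulrBl.
  by congr (_ / _); ring.
have lE : len (of_sphere p) = (mass (set_val p))^-1.
  rewrite /len; under eq_bigr do rewrite dE expr_div_n.
  rewrite -mulr_suml; have -> : \sum_i set_val p ord0 i ^+ 2 = 1 := set_valP p.
  by rewrite mul1r -exprVn sqrtr_sqr ger0_norm // invr_ge0 ltW.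
by rewrite mxE dE lE invrK divfK // lt0r_neq0.
Qed.

Lemma to_sphereK : cancel to_sphere of_sphere.
Proof.
move=> q; have l0 := len_gt0 q; apply: bcoord_inj => v.
rewrite bcoord_to_polyhedron; set p := set_val _.
have pE j : p ord0 j = dir q j / len q by rewrite /p /= mxE.
have bE : bot p = - bcoord q u0 / len q.
  apply/eqP; rewrite eq_le; apply/andP; split; last first.
    apply/bigmin_geP; split=> [|j _]; first by rewrite mulNr oppr_le0 divr_ge0 ?bcoord_ge0 // ltW.
    by rewrite pE ler_pM2r ?invr_gt0 // /dir lerBrDr addNr bcoord_ge0.
  have [w wA qw] := min0 q; have [wE|[j wE]] := cP wA.
    by rewrite -wE qw oppr0 mul0r.
  by apply: le_trans (bot_le p j) _; rewrite pE /dir -wE qw sub0r.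
have wE w : weight p w = bcoord q w / len q.
  have [wA|wA] := boolP (w \in x |: A); last by rewrite weight0 // bcoord0 // mul0r.
  have [->|[j ->]] := cP wA.
    by rewrite weight_u0 bE mulNr opprK.
  by rewrite weight_c bE pE -mulrBl /dir; congr (_ / _); ring.
rewrite -weight_sum; under [X in _ / X]eq_bigr do rewrite wE.
rewrite -mulr_suml bcoord_sum wE mul1r invrK divfK //.
exact: lt0r_neq0.
Qed.

Lemma to_sphere_continuous : continuous to_sphere.
Proof.
apply: continuous_comp_initial; apply: matrix_continuous => i j.
have cdir k : continuous (dir ^~ k).
  by apply: continuous_sub; exact: bcoord_continuous.
have clen : continuous len.
  apply: (@continuous_compose _ _ _ _ (@Num.sqrt R)); last exact: sqrt_continuous.
  apply: sum_continuous => k; rewrite [X in continuous X](_ : _ = fun q => dir q k * dir q k).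
    exact: continuous_mul.
  by apply/funext => q; rewrite expr2.
have -> : (fun q => (set_val \o to_sphere) q i j) = (fun q => dir q j / len q).
  by apply/funext => q; rewrite /= mxE.
apply: continuous_mul => //; apply: continuous_inv => // q.
exact: lt0r_neq0 (len_gt0 q).
Qed.

Lemma of_sphere_continuous : continuous of_sphere.
Proof.
have cp j : continuous (fun p : S => set_val p ord0 j).
  apply: (@continuous_compose _ _ _ (set_val : S -> 'rV[R]_d.+1) (fun M => M ord0 j)).
    exact: initial_continuous.
  exact: matrix_normedtype.coord_continuous.
have cbot : continuous (fun p : S => bot (set_val p)) by exact: bigmin_continuous.
have cmass : continuous (fun p : S => mass (set_val p)).
  by apply: continuous_sub => //; apply: sum_continuous => j; exact: continuous_sub.
apply: to_polyhedron_continuous => v; apply: continuous_mul.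
  apply: continuous_sub; last exact: continuous_scale.
  by apply: sum_continuous => j; exact: continuous_sub.
apply: continuous_inv => // p.
exact: lt0r_neq0 (mass_gt0 p).
Qed.

(** The chart sends [x] to the first basis vector, which is the base point of the sphere; thus all
    spheres of the wedge meet in the vertex [x]. *)
Lemma bcoord_of_sphere_base v : bcoord (of_sphere (sphere_base R d)) v = (v == x)%:R.
Proof.
rewrite bcoord_to_polyhedron; set p := set_val _.
have pE j : p ord0 j = (j == ord0)%:R by rewrite /p /= mxE eqxx.
have b0 : bot p = 0.
  apply/eqP; rewrite eq_le bot_le0; apply/bigmin_geP; split=> // j _.
  by rewrite pE ler0n.
have -> : mass p = 1.
  rewrite /mass b0 subr0 (bigD1 ord0) //= pE eqxx subr0 big1 ?addr0 //.
  by move=> j /negPf j0; rewrite pE j0 subr0.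
rewrite divr1; have [vA|vA] := boolP (v \in x |: A); last first.
  by rewrite weight0 //; case: eqVneq vA => // ->; rewrite !inE eqxx.
have x0 : x = c ord0 by rewrite /c eqxx.
have [->|[j ->]] := cP vA.
  by rewrite weight_u0 b0 oppr0 x0 eq_sym (negPf (c_neq _)).
by rewrite weight_c pE b0 subr0 x0 (inj_eq c_inj).
Qed.
End SphereChart.

Lemma vertex_bary_points (R : realType) (V : finType) (K : {set {set V}}) x :
  [set x]%SET \in K -> bary_points (R := R) K (fun v => (v == x)%:R).
Proof.
move=> xK; split=> [v||]; first by rewrite ler0n.
  by rewrite (bigD1 x) //= eqxx big1 ?addr0 // => v /negPf ->.
suff -> : supp (fun v => (v == x)%:R : R) = [set x]%SET by [].
by apply/finset.setP => v; rewrite !inE; case: (v == x); rewrite ?oner_eq0 ?eqxx.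
Qed.

Definition facets V (X : {set {set V}}) x := [set A in X | x |: A \notin X]%SET.

(** * The contraction of a complex in normal form *)

Section Standard.
Context {R : realType} {V : finType}.
Variables (X : {set {set V}}) (x : V).
Hypothesis sX : standard X x.
Local Notation F := (facets X x).
Implicit Types (A : {set V}) (y : polyhedron R X).

Lemma facetP A : A \in F -> [/\ A \in X, x \notin A, A != finset.set0 &
  forall B, B \in X -> A \subset B -> B = A].
Proof.
have [cX xX Xmax] := sX; rewrite inE => /andP[AX xAX]; split=> //.
- by apply: contra xAX => xA; rewrite (finset.setUidPr _) ?finset.sub1set ?inE.
- by apply: contraNneq xAX => ->; rewrite finset.setU0.
- by move=> B BX; exact: Xmax.
Qed.

Lemma facet_supp A y : A \in F -> A \subset supp (bcoord y) -> supp (bcoord y) = A.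
Proof. by move=> /facetP[_ _ _]; apply; exact: bcoord_supp. Qed.

Lemma depth_facet A y : A \in F -> supp (bcoord y) != A -> depth A (bcoord y) = 0.
Proof.
move=> AF yA; have [_ _ A0 _] := facetP AF; apply: depth_eq0 => //.
  by move=> v; rewrite bcoord_ge0 bcoord_le1.
by apply: contra yA => /(facet_supp AF) ->.
Qed.

(** The case to exclude is a proper subset [B] of [x |: A] with [x] in [B] and [B] not in [X]: then
    [B :\ x] would itself be a further facet, hence maximal and equal to [A]. *)
Lemma facet_boundary A : A \in F -> boundary x A \subset X.
Proof.
move=> AF; have [AX xA A0 Amax] := facetP AF; have [[_ Xdown] _ _] := sX.
apply/fintype.subsetP => B; rewrite inE => /properP[BA [v vA vB]].
have [xB|xB] := boolP (x \in B); last first.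
  apply: Xdown AX; apply/fintype.subsetP => u uB.
  by have := fintype.subsetP BA u uB; rewrite !inE => /predU1P[ux|//];
    rewrite ux (negPf xB) in uB.
have vx : v != x by apply: contra vB => /eqP ->.
have {}vA : v \in A by move: vA; rewrite !inE (negPf vx).
apply: contraT => BX; suff : B :\ x = A.
  by move/finset.setP/(_ v); rewrite !inE vA vx (negPf vB).
apply/eqP; rewrite finset.eqEsubset; apply/andP; split.
  by rewrite finset.subDset.
have BxX : B :\ x \in X.
  apply: Xdown AX; by rewrite finset.subDset.
have BF : B :\ x \in F by rewrite inE BxX finset.setD1K.
by have [_ _ _ Bmax] := facetP BF; rewrite (Bmax A AX) // finset.subDset.
Qed.

Lemma push_bary_points y (s : R) : 0 <= s <= 1 ->
  bary_points X (push x F s (bcoord y)).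
Proof.
move=> s01; have [[_ Xdown] xX _] := sX; have /andP[s0 s1] := s01.
have s2 : 0 <= 1 - s ^+ 2 by rewrite subr_ge0 expr_le1.
have [yF|yF] := boolP (supp (bcoord y) \in F).
  have [yX xy y0 _] := facetP yF.
  have E : push x F s (bcoord y) = push x [set supp (bcoord y)]%SET s (bcoord y).
    apply/funext => u; apply: push_near => // B BF By.
    by apply: depth_facet => //; rewrite eq_sym.
  rewrite E; split=> [u||].
  - by apply: push_ge0 => //; [exact: bcoord_ge0|exact: bcoord_sum].
  - by apply: push_sum => //; exact: bcoord_sum.
  - apply: (fintype.subsetP (facet_boundary yF)); rewrite inE.
    by apply: push_supp => //; [exact: bcoord_ge0|exact: bcoord_sum].
have E : push x F s (bcoord y) = (fun u => (1 - s ^+ 2) * bcoord y u + (u == x)%:R * s ^+ 2).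
  apply/funext => u; apply: push_far => // A AF; apply: depth_facet => //.
  by apply: contraNneq yF => ->.
rewrite E; split=> [u||].
- by rewrite addr_ge0 // mulr_ge0 ?bcoord_ge0 ?ler0n ?exprn_ge0.
- rewrite big_split /= -mulr_sumr -mulr_suml bcoord_sum.
  have [_ -> _] := vertex_bary_points R xX; ring.
apply: (@Xdown _ (x |: supp (bcoord y))).
  apply/fintype.subsetP => u; rewrite !inE; case: (eqVneq u x) => //= ux.
  by rewrite mul0r addr0 mulf_eq0 negb_or => /andP[].
by move: yF; rewrite inE bcoord_supp /= negbK.
Qed.

Lemma push1_bary_points A y : A \in F ->
  bary_points (boundary x A) (push x [set A]%SET 1 (bcoord y)).
Proof.
move=> AF; have [AX xA A0 _] := facetP AF.
have [yA|yA] := eqVneq (supp (bcoord y)) A.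
  have s01 : 0 <= (1 : R) <= 1 by rewrite ler01 lexx.
  split=> [u||].
  - by apply: push_ge0 => //; [exact: bcoord_ge0|exact: bcoord_sum].
  - by apply: push_sum => //; exact: bcoord_sum.
  - by rewrite inE; apply: push_supp => //; [exact: bcoord_ge0|exact: bcoord_sum].
have -> : push x [set A]%SET 1 (bcoord y) = (fun v => (v == x)%:R).
  apply/funext => u; rewrite push_far ?ler01 // => [|B].
    by rewrite expr1n subrr mul0r add0r mulr1.
  by rewrite inE => /eqP ->; exact: depth_facet.
apply: vertex_bary_points; rewrite inE finset.properEneq finset.subsetUl andbT.
apply: contraNneq A0 => /finset.setP xE; rewrite -finset.subset0.
apply/fintype.subsetP => u uA; have := xE u; rewrite !inE uA orbT => /eqP ux.
by rewrite -ux uA in xA.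
Qed.

Definition contraction (z : R * polyhedron R X) : polyhedron R X :=
  to_polyhedron (fun z : R * polyhedron R X =>
    push_bary_points z.2 (clamp_itv z.1)) z.

(** The open simplex [A] is spread over the boundary of [x |: A], and the rest of [X] goes to
    [x]. *)
Definition inflation A (AF : A \in F) : polyhedron R X -> polyhedron R (boundary x A) :=
  to_polyhedron (fun y => push1_bary_points y AF).

Definition vertex : polyhedron R X :=
  to_polyhedron (fun _ : unit => vertex_bary_points R (let: And3 _ h _ := sX in h)) tt.

Lemma contraction_continuous : continuous contraction.
Proof.
apply: to_polyhedron_continuous => v; apply: push_continuous.
  move=> u; exact: (continuous_compose (@snd_continuous _ _) (@bcoord_continuous _ _ _ u)).
exact: (continuous_compose (@fst_continuous _ _) clamp_continuous).
Qed.

Lemma inflation_continuous A (AF : A \in F) : continuous (inflation AF).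
Proof.
apply: to_polyhedron_continuous => v; apply: push_continuous.
  exact: bcoord_continuous.
exact: continuous_constant.
Qed.

Lemma contraction0 y : contraction (0, y) = y.
Proof.
apply: bcoord_inj => v; rewrite bcoord_to_polyhedron /= clamp_id ?lexx ?ler01 //.
have [yF|yF] := boolP (supp (bcoord y) \in F); last first.
  rewrite push_far ?lexx // => [|A AF]; first by rewrite expr0n subr0 mul1r mulr0 addr0.
  by apply: depth_facet => //; apply: contraNneq yF => ->.
rewrite (push_near _ _ yF) ?lexx // => [|B BF By]; last first.
  by apply: depth_facet => //; rewrite eq_sym.
have [yX xy y0 _] := facetP yF.
have s01 : 0 <= (0 : R) <= 1 by rewrite ler01 lexx.
have /andP[z0 z1] := depth_itv y0 (bcoord_ge0 y) (bcoord_sum y).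
have aE : push_scale [set supp (bcoord y)]%SET 0 (bcoord y) = 1.
  by rewrite /push_scale big_set1 addr0 min_r //; lra.
have bE : push_shift [set supp (bcoord y)]%SET 0 (bcoord y) (supp (bcoord y)) = 0.
  by rewrite /push_shift aE mul1r min_r.
by rewrite push1E aE bE subrr addr0 mulr0 mul0r mulr0 addr0 subr0 mul1r.
Qed.

(** With [contraction1] this says that the end of the contraction factors through the wedge of the
    boundaries: it is the inflation on each open facet and constant elsewhere. *)
Lemma contraction1_facet y A : A \in F -> supp (bcoord y) = A ->
  bcoord (contraction (1, y)) =1 push x [set A]%SET 1 (bcoord y).
Proof.
move=> AF yA v; rewrite bcoord_to_polyhedron /= clamp_id ?lexx ?ler01 //.
apply: push_near => // B BF BA; apply: depth_facet => //.
by rewrite yA eq_sym.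
Qed.

Lemma contraction1 y : supp (bcoord y) \notin F -> contraction (1, y) = vertex.
Proof.
move=> yF; apply: bcoord_inj => v.
rewrite !bcoord_to_polyhedron /= clamp_id ?lexx ?ler01 // push_far ?ler01 //.
  by rewrite expr1n subrr mul0r add0r mulr1.
by move=> A AF; apply: depth_facet => //; apply: contraNneq yF => ->.
Qed.

Lemma supp_vertex : supp (bcoord vertex) = [set x]%SET.
Proof.
apply/finset.setP => v; rewrite !inE bcoord_to_polyhedron.
by case: (v == x); rewrite ?oner_eq0 ?eqxx.
Qed.

(** The base vertex stays fixed at all times, so contractions of several spheres fit together on
    their wedge. *)
Lemma contraction_vertex (s : R) : contraction (s, vertex) = vertex.
Proof.
apply: bcoord_inj => v; rewrite bcoord_to_polyhedron /= push_far.
- by rewrite bcoord_to_polyhedron; ring.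
- move=> A AF; apply: depth_facet => //; rewrite supp_vertex.
  by have [_ xA _ _] := facetP AF; apply: contraNneq xA => <-; rewrite inE.
- by have /andP[] := clamp_itv s.
Qed.

(** Without further facets [X] is a cone with apex [x]. *)
Lemma standard_contractible : F = finset.set0 -> contractible R (polyhedron R X).
Proof.
move=> F0; exists vertex; have [cX _ _] := sX; apply: homotopic_linear => //.
- by move=> y; exact: cvg_id.
- exact: cst_continuous.
move=> y; rewrite supp_vertex finset.setUC; apply: contraT => yX.
have : supp (bcoord y) \in F by rewrite inE bcoord_supp.
by rewrite F0 inE.
Qed.
End Standard.

(** Each sphere of the wedge is itself in normal form, with [A] as its only further facet. So the
    contraction exists on it too, and this is the homotopy between the identity of the wedge and the
    composite through [X]. *)
Lemma boundary_standard (V : finType) (x : V) (A : {set V}) :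
  x \notin A -> A != finset.set0 ->
  standard (boundary x A) x /\ facets (boundary x A) x = [set A]%SET.
Proof.
move=> xA A0.
have fE B : B \in boundary x A -> (x |: B \notin boundary x A) = (B == A).
  rewrite !inE => BA; rewrite finset.properEneq negb_and negbK.
  rewrite finset.subUset finset.sub1set !inE eqxx (proper_sub BA) orbF.
  apply/eqP/eqP => [|->//]; have [xB|xB] := boolP (x \in B).
    by rewrite (finset.setUidPr _) ?finset.sub1set // => BE; rewrite BE fintype.properxx in BA.
  by move=> E; rewrite -(finset.setU1K xB) E finset.setU1K.
have AP : A \proper x |: A.
  rewrite finset.properEneq finset.subsetUr andbT; apply: contraNneq xA => ->.
  by rewrite !inE eqxx.
split; last first.
  apply/finset.setP => B; rewrite !inE -[X in X && _]/(_) andbC.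
  have [BA|BA] := boolP (B \in boundary x A).
    by have := fE B BA; rewrite inE => ->; move: BA; rewrite inE => ->; rewrite andbT.
  move: BA; rewrite inE => nBA; rewrite (negPf nBA) andbF; apply/esym/eqP => BE.
  by rewrite BE AP in nBA.
split.
- split=> [|B C BC]; rewrite !inE.
    by rewrite finset.proper0; apply/set0Pn; exists x; rewrite !inE eqxx.
  exact: fintype.sub_proper_trans.
- rewrite inE finset.properEneq finset.subsetUl andbT.
  apply: contraNneq A0 => /finset.setP xE; rewrite -finset.subset0.
  apply/fintype.subsetP => u uA; have := xE u; rewrite !inE uA orbT => /eqP ux.
  by rewrite -ux uA in xA.
move=> B C BA; rewrite fE // => /eqP -> CA AC; apply/eqP.
rewrite finset.eqEsubset AC andbT.
move: CA; rewrite inE => CA.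
have : (#|C| < #|x |: A|)%N by exact: proper_card.
rewrite cardsU1 xA add1n ltnS => cCA.
by have /eqP -> : A == C by rewrite eqEcard AC.
Qed.

Lemma sphere_closed1 (R : realType) d (p : sphere R d) : closed [set p].
Proof.
have -> : [set p] = (set_val : sphere R d -> 'rV[R]_d.+1) @^-1` [set set_val p].
  by apply/seteqP; split=> [q ->|q /= /val_inj].
move/continuous_closedP:
  (@initial_continuous _ _ (set_val : sphere R d -> 'rV[R]_d.+1)); apply.
exact/accessible_closed_set1/hausdorff_accessible/norm_hausdorff.
Qed.

(** At a point outside all [D i] the finitely many [g i] take the value [z0], so on a common
    neighbourhood they are all close to it; there [f] is one of them or [z0] itself. *)
Lemma continuous_select (T Z : topologicalType) (I : finType) (f : T -> Z)
    (g : I -> T -> Z) (D : I -> set T) (z0 : Z) :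
  (forall i, open (D i)) -> (forall i, continuous (g i)) ->
  (forall i t, D i t -> f t = g i t) ->
  (forall t, (forall i, ~ D i t) -> f t = z0) ->
  (forall i t, ~ D i t -> g i t = z0) -> continuous f.
Proof.
move=> oD cg fg f0 g0 t U Ut; have [[i Dit]|nD] := pselect (exists i, D i t).
  have : nbhs t (g i @^-1` U) by apply: cg; rewrite -(fg _ _ Dit).
  have : nbhs t (D i) by exact: open_nbhs_nbhs.
  by apply: filterS2 => s Dis Us /=; rewrite (fg i).
have {}nD i : ~ D i t by move=> Di; apply: nD; exists i.
have : \forall s \near t, forall i, U (g i s).
  by apply: filter_forall => i; apply: cg; rewrite g0 // -(f0 t nD).
apply: filterS => s Us /=; have [[i Dis]|nDs] := pselect (exists i, D i s).
  by rewrite (fg i).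
rewrite (f0 s) -?(f0 t nD); first exact: nbhs_singleton.
by move=> i Di; apply: nDs; exists i.
Qed.

(** * Equivalence of a normal form with a wedge of spheres *)

Section Wedge.
Context {R : realType} {V : finType}.
Variables (X : {set {set V}}) (x : V).
Hypotheses (sX : standard X x) (F0 : facets X x != finset.set0).
Local Notation F := (facets X x).

Let n := #|F|.-1.
Let cardF : #|F| = n.+1. Proof. by rewrite prednK // card_gt0. Qed.
Let A (i : 'I_n.+1) : {set V} := enum_val (cast_ord (esym cardF) i).
Let AF i : A i \in F. Proof. exact: enum_valP. Qed.
Let A_inj : injective A. Proof. by move=> i j /enum_val_inj /cast_ord_inj. Qed.
Let AE B : B \in F -> exists i, A i = B.
Proof.
move=> BF; exists (cast_ord cardF (enum_rank_in BF B)).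
by rewrite /A cast_ordK enum_rankK_in.
Qed.
Let xA i : x \notin A i. Proof. by have [] := facetP sX (AF i). Qed.
Let A0 i : A i != finset.set0. Proof. by have [] := facetP sX (AF i). Qed.
Let d i := #|A i|.-1.
Let cardA i : #|A i| = (d i).+1. Proof. by rewrite prednK // card_gt0 A0. Qed.

Local Notation W := (wedge_of_spheres R d).
Local Notation Y := (polyhedron R X).
Local Notation P i := (polyhedron R (boundary x (A i))).
Let base i := sphere_base R (d i).
Let lift {i} : sphere R (d i) -> W := @wedge_lift _ _ base i.

Let inclP i (q : P i) : bary_points X (bcoord q).
Proof.
have [q0 q1 qb] := bcoordP q; split=> //.
exact: (fintype.subsetP (facet_boundary sX (AF i))).
Qed.
Let incl i : P i -> Y := to_polyhedron (@inclP i).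
Let fold_at {i} (p : sphere R (d i)) : Y := incl (of_sphere (xA i) (cardA i) p).
Let fold : W -> Y := @wedge_fun _ _ base _ (@fold_at).
Let spread_at i (y : Y) : W :=
  lift (to_sphere (xA i) (cardA i) (inflation sX (AF i) y)).
Let spread (y : Y) : W :=
  if [pick i | supp (bcoord y) == A i] is Some i then spread_at i y
  else lift (base ord0).

Let fold_base i : fold_at (base i) = vertex sX.
Proof. by apply: bcoord_inj => v; exact: bcoord_of_sphere_base. Qed.

Let lift_base i j : lift (base i) = lift (base j).
Proof. exact: (@wedge_liftE _ _ base j (base j) i (base i)). Qed.

Let fold_lift i (p : sphere R (d i)) : fold (lift p) = fold_at p.
Proof. by apply: wedge_lift_funE => j k; rewrite !fold_base. Qed.

Let fold_continuous : continuous fold.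
Proof.
apply: wedge_fun_continuous => [i|i j]; last by rewrite !fold_base.
apply: (@continuous_compose _ _ _ _ (@incl i)); first exact: of_sphere_continuous.
by apply: to_polyhedron_continuous => v; exact: bcoord_continuous.
Qed.

Let spread_at_continuous i : continuous (spread_at i).
Proof.
apply: (@continuous_compose _ _ _ _ (@lift i)); last exact: (@wedge_lift_continuous _ _ base i).
apply: (@continuous_compose _ _ _ (inflation sX (AF i))).
  exact: inflation_continuous.
exact: to_sphere_continuous.
Qed.

Let to_sphere_base i (q : P i) : (forall v, bcoord q v = (v == x)%:R) ->
  to_sphere (xA i) (cardA i) q = base i.
Proof.
move=> qx; rewrite -[RHS](of_sphereK (xA i) (cardA i)); congr to_sphere.
by apply: bcoord_inj => v; rewrite qx bcoord_of_sphere_base.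
Qed.

Let spread_at_far i (y : Y) : supp (bcoord y) != A i -> spread_at i y = lift (base ord0).
Proof.
move=> yA; rewrite /spread_at to_sphere_base ?(lift_base ord0 i) // => v.
rewrite bcoord_to_polyhedron push_far ?ler01 // => [|B].
  by rewrite expr1n subrr mul0r add0r mulr1.
by rewrite inE => /eqP ->; exact: (depth_facet sX).
Qed.

Let spread_facet i (y : Y) : supp (bcoord y) = A i -> spread y = spread_at i y.
Proof.
move=> yA; rewrite /spread; case: pickP => [j|/(_ i)]; last by rewrite yA eqxx.
by rewrite yA => /eqP /A_inj ->.
Qed.

Let spread_far (y : Y) : supp (bcoord y) \notin F -> spread y = lift (base ord0).
Proof.
move=> yF; rewrite /spread; case: pickP => // i /eqP yA.
by rewrite yA AF in yF.
Qed.

Let spread_continuous : continuous spread.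
Proof.
(* The interior of the facet [A i] is where the least coordinate over [A i] is positive, hence an
   open set. *)
pose m i (y : Y) := \big[Num.min/1]_(u in A i) bcoord y u.
have mP i y : 0 < m i y <-> supp (bcoord y) = A i.
  split=> [/bigmin_gtP[_ m0]|yA].
    apply: (facet_supp sX (AF i)); apply/fintype.subsetP => u /m0 yu.
    by rewrite inE lt0r_neq0.
  apply/bigmin_gtP; split=> [|u]; first exact: ltr01.
  by rewrite -yA inE lt_neqAle eq_sym bcoord_ge0 => ->.
apply: (@continuous_select _ _ _ _ spread_at
  (fun i => [set y | 0 < m i y]) (lift (base ord0))).
- move=> i; have cm : continuous (m i).
    by apply: bigmin_continuous => u; exact: bcoord_continuous.
  have : open (m i @^-1` [set r : R | 0 < r]).
    have /continuousP := cm; apply; exact: open_gt.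
  by [].
- exact: spread_at_continuous.
- by move=> i y /mP; exact: spread_facet.
- move=> y yA; apply: spread_far; apply/negP => /AE[i iE].
  by apply: (yA i); apply/mP.
- by move=> i y /mP /eqP; exact: spread_at_far.
Qed.

Let spread_foldK : homotopic R (fold \o spread) idfun.
Proof.
apply: homotopic_sym; apply/homotopicP; exists (contraction sX).
split=> [|y|y]; [exact: contraction_continuous|exact: contraction0|].
have [/AE[i yA]|yF] := boolP (supp (bcoord y) \in F); last first.
  by rewrite contraction1 //= spread_far // fold_lift fold_base.
rewrite /= (@spread_facet i) // fold_lift /fold_at to_sphereK.
by apply: bcoord_inj => v; rewrite (contraction1_facet sX (AF i)).
Qed.

Let fold_spreadK : homotopic R (spread \o fold) idfun.
Proof.
pose H i (s : R) (p : sphere R (d i)) : W :=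
  let sB := (boundary_standard (xA i) (A0 i)).1 in
  lift (to_sphere (xA i) (cardA i) (contraction sB (s, of_sphere (xA i) (cardA i) p))).
have Hbase i s : H i s (base i) = lift (base ord0).
  rewrite /H; set sB := (_.1); rewrite (lift_base ord0 i); congr lift.
  have -> : of_sphere (xA i) (cardA i) (base i) = vertex sB.
    by apply: bcoord_inj => v; exact: bcoord_of_sphere_base.
  by rewrite contraction_vertex; apply: to_sphere_base => v.
have surj w : exists i (p : sphere R (d i)), w = lift p.
  have : [set: W] w by [].
  by rewrite -(wedgeTE base) => -[i _ [p _ <-]]; exists i, p.
apply: homotopic_sym; apply/homotopicP.
exists (uncurry (fun s => @wedge_fun _ _ base _ (fun i => H i s))); split.
- apply: wedge_fun_joint_continuous.
  + exact: finite_finset.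
  + by move=> i; exact: sphere_closed1.
  + by move=> s i j; rewrite !Hbase.
  + move=> i; set sB := (boundary_standard (xA i) (A0 i)).1.
    have cof : continuous (fun z : R * sphere R (d i) =>
        (z.1, of_sphere (xA i) (cardA i) z.2)).
      move=> z; apply: (@cvg_pair _ _ _ _ (nbhs z.1)
        (nbhs (of_sphere (xA i) (cardA i) z.2))); first exact: cvg_fst.
      exact: (continuous_compose (@snd_continuous _ _)
        (@of_sphere_continuous _ _ _ _ _ (xA i) (cardA i)) (x := z)).
    have -> : uncurry (H i) = fun z => lift (to_sphere (xA i) (cardA i)
        (contraction sB (z.1, of_sphere (xA i) (cardA i) z.2))).
      by apply/funext => -[].
    apply: (@continuous_compose _ _ _ _ (@lift i)); last exact: (@wedge_lift_continuous _ _ base i).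
    apply: (@continuous_compose _ _ _ _ (to_sphere (xA i) (cardA i))); last first.
      exact: to_sphere_continuous.
    by apply: (continuous_compose (g := contraction sB) cof); exact: contraction_continuous.
- move=> w; have [i [p ->]] := surj w.
  rewrite /= wedge_lift_funE; last by move=> j k; rewrite !Hbase.
  by rewrite /H contraction0 of_sphereK.
move=> w; have [i [p ->]] := surj w.
rewrite /= wedge_lift_funE; last by move=> j k; rewrite !Hbase.
rewrite fold_lift /H /fold_at; set sB := (_.1).
set q := of_sphere _ _ p.
have FB := (boundary_standard (xA i) (A0 i)).2.
have [qA|qA] := eqVneq (supp (bcoord q)) (A i).
  rewrite (@spread_facet i) //; congr (lift (to_sphere _ _ _)).
  apply: bcoord_inj => v; rewrite (@contraction1_facet _ _ _ _ _ _ (A i)) //.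
  by rewrite FB inE.
(* A further facet of [X] inside [x |: A i] misses [x], so it lies in [A i] and equals it by
   maximality; hence [q] is interior to no further facet of [X]. *)
rewrite spread_far; last first.
  apply: contraNN qA => /AE[j jE]; have {}jE : A j = supp (bcoord q) := jE.
  have [_ _ _ jmax] := facetP sX (AF j); have [iX _ _ _] := facetP sX (AF i).
  rewrite -jE (jmax _ iX) //.
  have := bcoord_supp q; rewrite -jE inE => /proper_sub /fintype.subsetP jA.
  apply/fintype.subsetP => u uA; have := jA u uA; rewrite !inE => /predU1P[ux|//].
  by have := xA j; rewrite -ux uA.
rewrite contraction1; last by rewrite FB inE.
by rewrite to_sphere_base.
Qed.

Lemma standard_wedge : exists (m : nat) (e : 'I_m.+1 -> nat),
  homotopy_equivalent R Y (wedge_of_spheres R e).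
Proof. by exists n, d, spread, fold; split. Qed.
End Wedge.

(** * Young complexes *)

Section Realization.
Context {R : realType} {V : finType} {U : choiceType}.
Variables (C : simplicial_complex U) (K : {set {set V}}) (f : V -> U).
Hypotheses (f_inj : injective f) (cK : is_complex K).

Let image_of (s : {fset U}) (S : {set V}) := s =i [seq f v | v in S].

Hypothesis faceP : forall s, faces C s <-> exists2 S, S \in K & image_of s S.

Let sum_image s S (g : U -> R) : image_of s S ->
  \sum_(u <- s) g u = \sum_(v in S) g (f v).
Proof.
move=> sS; rewrite (perm_big [seq f v | v in S]).
  by rewrite big_map big_enum.
apply: uniq_perm => //.
by rewrite map_inj_uniq // enum_uniq.
Qed.

Let push (y : polyhedron R K) (u : U) : R := \sum_(v | f v == u) bcoord y v.
Let pull (x : realization R C) (v : V) : R := set_val x (f v).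

Let pushE y v : push y (f v) = bcoord y v.
Proof. by rewrite /push (big_pred1 v) // => w /=; exact: inj_eq. Qed.

Let pushN y u : u \notin codom f -> push y u = 0.
Proof.
move=> uf; rewrite /push big_pred0 // => v; apply: contraNF uf => /eqP <-.
exact: codom_f.
Qed.

Let pushP y : @barycentric R U C (push y).
Proof.
split=> [u|]; first by apply: sumr_ge0 => v _; exact: bcoord_ge0.
pose S := supp (bcoord y).
exists [fset u in [seq f v | v in S]]%fset.
have sS : image_of [fset u in [seq f v | v in S]]%fset S by move=> u; rewrite !inE.
split.
- by apply/faceP; exists S => //; exact: bcoord_supp.
- move=> u; rewrite sS => uS; have [/codomP[v uE]|/pushN //] := boolP (u \in codom f).
  rewrite uE pushE; apply/eqP; apply: contraNT uS => yv; rewrite uE.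
  by apply/fintype.imageP; exists v => //; rewrite !inE.
- rewrite (sum_image _ sS) -(bcoord_sum y) [RHS](bigID (mem S)) /=.
  rewrite [X in _ + X]big1 ?addr0 => [|v]; first by apply: eq_bigr => v _; exact: pushE.
  by rewrite inE negbK => /eqP.
Qed.

Let pullP x : bary_points K (pull x).
Proof.
have [x0 [s [/faceP[S SK sS] xs xsum]]] := set_valP x.
have xS v : v \notin S -> pull x v = 0.
  move=> vS; apply: xs; rewrite sS; apply: contra vS => /fintype.imageP[w wS /f_inj ->].
  exact: wS.
split=> [v||]; first exact: x0.
- rewrite (bigID (mem S)) /= [X in _ + X]big1 ?addr0; last by move=> v; exact: xS.
  by rewrite -xsum (sum_image _ sS).
case: cK => _; apply; last exact: SK.
by apply/fintype.subsetP => v; rewrite inE; apply: contraNT => /xS ->.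
Qed.

Let to_realization (y : polyhedron R K) : realization R C :=
  exist _ (push y : {ptws U -> R}) (mem_set (pushP y)).

(** Transport of coordinates along [f] is in fact a homeomorphism: a point of the realization is
    supported on a face of [C], hence inside the image of [f]. *)
Lemma polyhedron_realization :
  homotopy_equivalent R (polyhedron R K) (realization R C).
Proof.
have c1 : continuous to_realization.
  apply: continuous_comp_initial; apply: ptws_continuous => u.
  by apply: sum_continuous => v; exact: bcoord_continuous.
have c2 : continuous (to_polyhedron pullP).
  apply: to_polyhedron_continuous => v.
  apply: (@continuous_compose _ _ _
    (set_val : realization R C -> {ptws U -> R}) (fun g => g (f v))).
    exact: initial_continuous.
  exact: (@proj_continuous _ (fun=> R : topologicalType)).
exists to_realization, (to_polyhedron pullP); split=> //; apply: homotopic_eq.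
- exact: continuous_compose c1 c2.
- by move=> y; apply: bcoord_inj => v; exact: pushE.
- exact: continuous_compose c2 c1.
move=> x; apply: val_inj; apply/funext => u /=; rewrite -[LHS]/(push _ u).
have [/codomP[v ->]|uf] := boolP (u \in codom f); first by rewrite pushE.
rewrite pushN //; have [_ [s [/faceP[S SK sS] xs _]]] := set_valP x.
apply/esym/xs; rewrite sS; apply: contra uf => /fintype.imageP[v _ ->].
exact: codom_f.
Qed.
End Realization.

(** * Faces of the Young complex as words *)

Section YoungFaces.
Variables (t : nat) (lam : seq nat).
Hypotheses (t_gt0 : (0 < t)%N) (lamP : is_partition lam).
Let r := (size lam).-1.
Let n := head 0%N lam.

(** Here [m] counts the rows below a box, which become the blocks of a word: the box is in row
    [r - m], with entry [m * t + i.+1]. The bound [m <= r] guards the truncated subtraction. *)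
Definition allowed (i m : nat) : bool := (m <= r)%N && (i < nth 0%N lam (r - m))%N.

Lemma size_partition : size lam = r.+1.
Proof. by rewrite prednK //; case: lam lamP. Qed.

Lemma nth_partition j j' : (j <= j')%N -> (nth 0 lam j' <= nth 0 lam j)%N.
Proof.
move=> jj'; have [j'l|lj'] := ltnP j' (size lam); last by rewrite nth_default.
have /and3P[_ lam_sorted _] := lamP.
apply: (sorted_leq_nth (leT := geq)) => //.
- by move=> a b c ba cb; exact: leq_trans cb ba.
- by move=> a; exact: leqnn.
- by rewrite inE (leq_ltn_trans jj').
Qed.

Lemma allowed_up i m m' : allowed i m -> (m <= m' <= r)%N -> allowed i m'.
Proof.
case/andP=> mr im /andP[mm' m'r]; rewrite /allowed m'r.
by apply: leq_trans im _; apply: nth_partition; exact: leq_sub2l.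
Qed.

Lemma allowed_down i i' m : allowed i m -> (i' <= i)%N -> allowed i' m.
Proof. by case/andP=> mr im ii'; rewrite /allowed mr (leq_ltn_trans ii'). Qed.

Lemma allowed_max i : (i < n)%N -> allowed i r.
Proof. by move=> i_n; rewrite /allowed leqnn subnn nth0. Qed.

Lemma column_entry i y : column t lam i y <->
  exists2 m, allowed i m & y = (m * t + i).+1%N.
Proof.
split=> [[j /= /andP[jl ij] <-]|[m /andP[mr im] ->]].
  have jr : (j <= r)%N by rewrite -ltnS -size_partition.
  exists (r - j)%N; first by rewrite /allowed leq_subr subKn.
  by rewrite /box_entry size_partition subSS addnS.
exists (r - m)%N => /=; first by rewrite size_partition ltnS leq_subr.
by rewrite /box_entry size_partition subSS subKn // addnS.
Qed.

(* Positions are counted from 0, box entries from 1. *)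
Lemma young_facesP (s : {fset nat}) : young_faces t lam s <->
  exists2 S : {set 'I_(r * t + n)}, S \in word_faces t n r allowed 0 0 0 &
    s =i [seq (val v).+1 | v in S].
Proof.
split=> [[F [a [sza a_sorted acol ->]] sF]|[S /word_facesP[m [m1 m2] mS] sS]].
  have mex i : exists m, (i < n)%N -> allowed i m /\ nth 0%N a i = (m * t + i).+1.
    have [i_n|_] := ltnP i n; last by exists 0%N.
    by have := acol i; rewrite sza => /(_ i_n)/column_entry[m ? ?]; exists m.
  have [m mP] := choice mex.
  (* Consecutive entries increase strictly while the column index grows by one, so
     [m j' * t <= m j'.+1 * t], and [t] can be cancelled. *)
  have m_mono j j' : (j <= j')%N -> (j' < n)%N -> (m j <= m j')%N.
    elim: j' => [|j' IH]; first by rewrite leqn0 => /eqP ->.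
    rewrite leq_eqVlt => /predU1P[->//|]; rewrite ltnS => jj' j'n.
    apply: leq_trans (IH jj' (ltnW j'n)) _.
    have [_ e1] := mP _ (ltnW j'n); have [_ e2] := mP _ j'n.
    have : (nth 0 a j' < nth 0 a j'.+1)%N.
      by apply: (sorted_ltn_nth ltn_trans) => //; rewrite inE sza // ltnW.
    rewrite e1 e2 => h; rewrite -(leq_pmul2r t_gt0); lia.
  have sE u : u \in s -> exists i, [/\ (i < n)%N & u = (m i * t + i).+1].
    move=> us; have := fsubsetP sF u us; rewrite inE => /(nthP 0%N)[i].
    by rewrite sza => i_n <-; exists i; split=> //; have [] := mP i i_n.
  exists [set v : 'I_(r * t + n) | (val v).+1 \in s]%SET.
    apply/word_facesP; exists m.
      split=> [j jn|j j' _ /andP[jj' j'n]]; last exact: m_mono.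
      have [/andP[mr jm] _] := mP j jn.
      by rewrite /allowed mr.
    move=> v; rewrite inE => /sE[i [i_n /succn_inj vE]]; split=> //.
    by exists i.
  move=> u; apply/idP/fintype.imageP => [us|[v]]; last by rewrite inE => ? ->.
  have [i [i_n uE]] := sE u us.
  have vN : (m i * t + i < r * t + n)%N.
    have [/andP[mr _] _] := mP i i_n.
    by have := leq_mul mr (leqnn t); lia.
  by exists (Ordinal vN); rewrite ?inE -uE.
pose a := mkseq (fun i => (m i * t + i).+1) n.
exists [fset x in a]%fset.
  exists a; split=> //; first by rewrite size_mkseq.
  - apply/(sortedP 0%N) => i; rewrite size_mkseq => i_n.
    rewrite !nth_mkseq ?(ltnW i_n) //.
    have : (m i <= m i.+1)%N by apply: m2; rewrite ?leqnSn.
    by move=> h; have := leq_mul h (leqnn t); lia.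
  - move=> i; rewrite size_mkseq => i_n; apply/column_entry; exists (m i).
      by have [] := m1 i i_n.
    by rewrite nth_mkseq.
apply/fsubsetP => u; rewrite sS inE => /fintype.imageP[v /mS[_ [i i_n vE]] ->].
by rewrite /= vE; apply/mapP; exists i => //; rewrite mem_iota.
Qed.
End YoungFaces.

Lemma good_wedge_of_spheres (R : realType) (V : finType) (K : {set {set V}}) w :
  good K w -> contractible R (polyhedron R K) \/
  exists (n : nat) (d : 'I_n.+1 -> nat),
    homotopy_equivalent R (polyhedron R K) (wedge_of_spheres R d).
Proof.
move=> [W [X [x [/peq_homotopy_equivalent KX sX]]]].
have [F0|F0] := eqVneq (facets X x) finset.set0; [left|right].
  exact: contractible_equivalent (KX R) (standard_contractible sX F0).
have [n [d XW]] := @standard_wedge R _ _ _ sX F0.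
by exists n, d; exact: homotopy_equivalent_trans (KX R) XW.
Qed.

Theorem theorem0p2 (R : realType) (t : nat) (lam : seq nat)
    (ht : (0 < t)%N) (hlam : is_partition lam) :
  contractible R (realization R (young_complex t lam)) \/
  exists (n : nat) (d : 'I_n.+1 -> nat),
    homotopy_equivalent R (realization R (young_complex t lam))
      (wedge_of_spheres R d).
Proof.
pose n := head 0%N lam; pose r := (size lam).-1; pose al := allowed lam.
pose K := word_faces t n r al 0 0 0.
have n_gt0 : (0 < n)%N.
  by move: hlam; rewrite /n /is_partition; case: (lam) => // a l /= /and3P[].
have cK : is_complex K by apply: word_faces_complex; [exact: allowed_max|].
have KY : homotopy_equivalent R (polyhedron R K) (realization R (young_complex t lam)).
  apply: (@polyhedron_realization _ _ _ _ _ (fun v => (val v).+1)) => //.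
    by move=> v w /succn_inj /val_inj.
  exact: young_facesP.
have [w Kw] : exists w, good K w.
  have [_ /(_ 0%N)] := @word_faces_good t n r al ht (allowed_up hlam)
    (@allowed_down lam) (@allowed_max lam) _ 0 0 isT isT (ltnSn _).
  (* The complex has a vertex, the position of the first letter after all [r] blocks, so it is not
     the empty one. *)
  case=> // K0; exfalso.
  have xN : (r * t + 0 < r * t + n)%N by rewrite ltn_add2l.
  have : [set Ordinal xN; Ordinal xN]%SET \in K.
    apply: (@word_faces2 t n r al ht (@allowed_down lam) (@allowed_max lam) 0 0 0 0 r 0) => //.
    - by rewrite leqnn.
    - exact: allowed_max.
    - by left.
  rewrite /K K0 finset.in_set1 => /eqP /finset.setP /(_ (Ordinal xN)).
  by rewrite !inE eqxx.
have [ctr|[m [d KW]]] := @good_wedge_of_spheres R _ _ _ Kw; [left|right].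
  exact: contractible_equivalent (homotopy_equivalent_sym KY) ctr.
by exists m, d; exact: homotopy_equivalent_trans (homotopy_equivalent_sym KY) KW.
Qed.
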